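(* Let $P=\{p_1,\ldots,p_n\}$ be a finite poset and $r\ge s\ge1$. The Rees ring $\mathcal R(H_{r,s}(P))$ is Koszul.
   Context: $K$ is a field and $S=K[x_{ij} : 1\le i\le r,\ 1\le j\le n]$. A multichain of length $r$ in $P$ is a sequence $C: p_{j_1}\le\cdots\le p_{j_r}$ of elements of $P$ (repetitions allowed). For $\emptyset\ne A\subseteq[r]=\{1,\ldots,r\}$ set $u_{C,A}=\prod_{i\in A}x_{ij_i}$. $I_{r,s}(P)\subset S$ is generated by all $u_{C,A}$ with $C$ a multichain of length $r$ in $P$ and $A\subseteq[r]$, $|A|=s$. The Alexander dual $I^\vee$ of a squarefree monomial ideal $I$ is the ideal generated by the monomials $\prod_{x\in F}x$, where $F$ ranges over the sets of variables generating the minimal prime ideals of $I$. Put $H_{r,s}(P)=I_{r,s}(P)^\vee$; its minimal monomial generators $u_1,\ldots,u_m$ all have the same degree. The Rees ring $\mathcal R(H_{r,s}(P))=\bigoplus_{j\ge0}H_{r,s}(P)^jt^j\subset S[t]$ is bigraded with $\deg x_{ij}=(1,0)$ and $\deg u_kt=(0,1)$, and is viewed as a standard graded $K$-algebra via the total degree. *)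

(* Defs.v *)
(* Sets are boolean predicates; the classical truth value `[< P >] of boolp
   makes a {pred T} out of an arbitrary proposition. *)
From HB Require Import structures.
From mathcomp Require Import all_boot all_order all_algebra.
From mathcomp Require Import boolp mpoly.
Set Implicit Arguments.
Unset Strict Implicit.
Unset Printing Implicit Defensive.
Import GRing.Theory.
Local Open Scope ring_scope.

Definition lspan (K : nzRingType) (V : lmodType K) (X : {pred V}) : {pred V} :=
  fun v => `[< exists s : seq (K * V),
    {subset [seq z.2 | z <- s] <= X} /\ v = \sum_(z <- s) z.1 *: z.2 >].

Definition ideal_gen (R : comNzRingType) (G : {pred R}) : {pred R} :=
  fun f => `[< exists s : seq (R * R),
    {subset [seq z.2 | z <- s] <= G} /\ f = \sum_(z <- s) z.1 * z.2 >].

(* The j-th power of the ideal generated by G (the unit ideal for j = 0). *)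
Definition ideal_pow (R : comNzRingType) (G : {pred R}) (j : nat) : {pred R} :=
  ideal_gen (fun f => `[< exists t : j.-tuple R,
    {subset t <= G} /\ f = \prod_(x <- t) x >]).

Definition prime_ideal (R : comNzRingType) (Q : {pred R}) : Prop :=
  idealr_closed Q /\ prime_idealr_closed Q.

Definition minimal_prime (R : comNzRingType) (I Q : {pred R}) : Prop :=
  [/\ prime_ideal Q, {subset I <= Q} &
      forall Q' : {pred R}, prime_ideal Q' -> {subset I <= Q'} ->
        {subset Q' <= Q} -> {subset Q <= Q'}].

Section IdealPowers.
Variables (R : comNzRingType) (G : {pred R}).

Lemma ideal_gen0 : 0 \in ideal_gen G.
Proof. by apply/asboolP; exists [::]; rewrite big_nil. Qed.

Lemma ideal_genD f g :
  f \in ideal_gen G -> g \in ideal_gen G -> f + g \in ideal_gen G.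
Proof.
move=> /asboolP[s [sG ->]] /asboolP[s' [sG' ->]].
apply/asboolP; exists (s ++ s'); rewrite big_cat; split=> // x.
by rewrite map_cat mem_cat => /orP[/sG|/sG'].
Qed.

Lemma ideal_genM a f : f \in ideal_gen G -> a * f \in ideal_gen G.
Proof.
move=> /asboolP[s [sG ->]]; apply/asboolP.
exists [seq (a * z.1, z.2) | z <- s]; split.
  by move=> x; rewrite -map_comp => /sG.
by rewrite big_map mulr_sumr; apply: eq_bigr => z _ /=; rewrite mulrA.
Qed.

Lemma ideal_gen_incl f : f \in G -> f \in ideal_gen G.
Proof.
move=> fG; apply/asboolP; exists [:: (1, f)]; rewrite big_seq1 mul1r.
by split=> // x; rewrite inE => /eqP->.
Qed.

Lemma ideal_gen_sum (T : Type) (s : seq T) (F : T -> R) :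
  (forall i, F i \in ideal_gen G) -> \sum_(i <- s) F i \in ideal_gen G.
Proof.
move=> FG; elim/big_ind: _ => //; first exact: ideal_gen0.
exact: ideal_genD.
Qed.

End IdealPowers.

Lemma ideal_powM (R : comNzRingType) (G : {pred R}) i j f g :
  f \in ideal_pow G i -> g \in ideal_pow G j -> f * g \in ideal_pow G (i + j).
Proof.
move=> /asboolP[s [sG ->]] /asboolP[s' [sG' ->]].
rewrite mulr_suml big_seq; elim/big_ind: _ => [||z zs].
- exact: ideal_gen0.
- exact: ideal_genD.
rewrite mulr_sumr big_seq; elim/big_ind: _ => [||z' zs'].
- exact: ideal_gen0.
- exact: ideal_genD.
rewrite mulrACA; apply/ideal_genM/ideal_gen_incl/asboolP.
have /asboolP[t [tG ->]] := sG _ (map_f snd zs).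
have /asboolP[t' [tG' ->]] := sG' _ (map_f snd zs').
exists [tuple of t ++ t']; rewrite big_cat; split=> // x.
by rewrite mem_cat => /orP[/tG|/tG'].
Qed.

Lemma ideal_pow0 (R : comNzRingType) (G : {pred R}) f : f \in ideal_pow G 0.
Proof.
rewrite -[f]mulr1; apply/ideal_genM/ideal_gen_incl/asboolP.
by exists [tuple]; rewrite big_nil.
Qed.

(* The Rees ring of the ideal H, as the subring of S[t] = {poly S} of the
   polynomials whose coefficient of t^j lies in H^j for all j. *)
Definition rees_pred (S : comNzRingType) (H : {pred S}) : {pred {poly S}} :=
  fun f => `[< forall j, f`_j \in ideal_pow H j >].

Section ReesPred.
Variables (S : comNzRingType) (H : {pred S}).

Lemma rees_pred_subring : subring_closed (rees_pred H).
Proof.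
split.
- apply/asboolP => -[|j]; first exact: ideal_pow0.
  by rewrite coef1; apply: ideal_gen0.
- move=> f g /asboolP fR /asboolP gR; apply/asboolP => j.
  by rewrite coefB -mulN1r; apply: ideal_genD => //; apply: ideal_genM.
- move=> f g /asboolP fR /asboolP gR; apply/asboolP => j.
  rewrite coefM; apply: ideal_gen_sum => i.
  by have := ideal_powM (fR i) (gR (j - i)%N); rewrite subnKC // leq_ord.
Qed.

HB.instance Definition _ :=
  GRing.isSubringClosed.Build {poly S} (rees_pred H) rees_pred_subring.

Lemma rees_predZ a f : f \in rees_pred H -> a *: f \in rees_pred H.
Proof.
by move=> /asboolP fR; apply/asboolP => j; rewrite coefZ; apply: ideal_genM.
Qed.

End ReesPred.

Section Rees.
Variables (K : fieldType) (S : comAlgType K) (H : {pred S}).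

Record rees : Type := Rees {
  rees_val : {poly S};
  rees_valP : rees_val \in rees_pred H }.

HB.instance Definition _ := [isSub for rees_val].
HB.instance Definition _ := [Choice of rees by <:].
HB.instance Definition _ := [SubChoice_isSubComNzRing of rees by <:].

Definition rees_scale (c : K) (f : rees) : rees :=
  Rees (rees_predZ c%:A (rees_valP f)).

Lemma rees_scaleA a b v :
  rees_scale a (rees_scale b v) = rees_scale (a * b) v.
Proof. by apply: val_inj; rewrite /= scalerA -scalerAl mul1r scalerA. Qed.

Lemma rees_scale1 : left_id 1 rees_scale.
Proof. by move=> v; apply: val_inj; rewrite /= !scale1r. Qed.

Lemma rees_scaleDr : right_distributive rees_scale +%R.
Proof. by move=> a u v; apply: val_inj; rewrite /= scalerDr. Qed.

Lemma rees_scaleDl v : {morph rees_scale^~ v : a b / a + b}.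
Proof. by move=> a b; apply: val_inj; rewrite /= !scalerDl. Qed.

HB.instance Definition _ := GRing.Zmodule_isLmodule.Build K rees
  rees_scaleA rees_scale1 rees_scaleDr rees_scaleDl.

Lemma rees_scaleAl (a : K) (u v : rees) : a *: (u * v) = a *: u * v.
Proof. by apply: val_inj; rewrite /= scalerAl. Qed.

HB.instance Definition _ :=
  GRing.Lmodule_isLalgebra.Build K rees rees_scaleAl.

Lemma rees_scaleAr (a : K) (u v : rees) : a *: (u * v) = u * (a *: v).
Proof. by rewrite mulrC rees_scaleAl mulrC. Qed.

HB.instance Definition _ :=
  GRing.Lalgebra_isAlgebra.Build K rees rees_scaleAr.

End Rees.

Section Koszul.
Variables (K : fieldType) (A : comAlgType K) (gr : nat -> {pred A}).

Definition graded_algebra : Prop :=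
  [/\ forall i, submod_closed (gr i),
      1 \in gr 0,
      forall i j x y, x \in gr i -> y \in gr j -> x * y \in gr (i + j)%N,
      forall x, exists n (f : nat -> A),
        (forall i, f i \in gr i) /\ x = \sum_(i < n) f i &
      forall n (f : nat -> A), (forall i, f i \in gr i) ->
        \sum_(i < n) f i = 0 -> forall i, (i < n)%N -> f i = 0].

Definition standard_graded : Prop :=
  [/\ graded_algebra,
      forall x, x \in gr 0 <-> exists c : K, x = c%:A &
      exists s : seq A, {subset s <= gr 1} /\
        forall i, {subset gr i <= lspan (fun x => `[< exists t : i.-tuple A,
          {subset t <= s} /\ x = \prod_(y <- t) y >])}].

Definition irrelevant_ideal : {pred A} :=
  fun x => `[< exists n (f : nat -> A),
    (forall i, f i \in gr i.+1) /\ x = \sum_(i < n) f i >].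

(* K = A / A_+ has a linear free resolution over A,
     ... -> A(-2)^(b 2) -> A(-1)^(b 1) -> A^(b 0) = A -> K -> 0.
   Free modules are spaces of row vectors and the i-th differential is
   v |-> v *m D i; it is homogeneous of degree 0 as a map
   A(-i-1)^(b i.+1) -> A(-i)^(b i) iff the entries of D i lie in A_1. *)
Definition linear_resolution : Prop :=
  exists (b : nat -> nat) (D : forall i, 'M[A]_(b i.+1, b i)),
    [/\ b 0 = 1%N,
        forall i k l, D i k l \in gr 1,
        forall v : 'rV[A]_(b 0),
          (exists w, v = w *m D 0) <-> (forall k l, v k l \in irrelevant_ideal) &
        forall i (v : 'rV[A]_(b i.+1)),
          v *m D i = 0 <-> (exists w, v = w *m D i.+1)].

Definition koszul : Prop := standard_graded /\ linear_resolution.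

End Koszul.

Section AlexanderDual.
Variables (K : fieldType) (N : nat).
Local Notation S := {mpoly K[N]}.

Definition var_ideal (F : {set 'I_N}) : {pred S} :=
  ideal_gen (fun f => `[< exists2 i, i \in F & f = 'X_i >]).

Definition alexander_dual (I : {pred S}) : {pred S} :=
  ideal_gen (fun f => `[< exists2 F : {set 'I_N},
    minimal_prime I (var_ideal F) & f = \prod_(i in F) 'X_i >]).

Definition min_monomial_gen (H : {pred S}) (u : 'X_{1..N}) : Prop :=
  'X_[u] \in H /\
  forall m : 'X_{1..N}, 'X_[m] \in H -> (m <= u)%MM -> m = u.

(* The bigrading of the Rees ring with deg x_i = (1, 0) and
   deg (u t) = (0, 1) for every minimal monomial generator u of H. *)
Definition rees_bigr (H : {pred S}) (a b : nat) : {pred rees H} :=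
  lspan (fun f => `[< exists (m : 'X_{1..N}) (u : b.-tuple 'X_{1..N}),
    [/\ mdeg m = a, forall k, min_monomial_gen H (tnth u k) &
        rees_val f = ('X_[m] * \prod_(k < b) 'X_[tnth u k]) *: 'X^b] >]).

Definition rees_gr (H : {pred S}) (d : nat) : {pred rees H} :=
  fun f => `[< exists g : 'I_d.+1 -> rees H,
    (forall b, g b \in rees_bigr (d - b) b) /\ f = \sum_b g b >].

End AlexanderDual.

Arguments rees_bigr {K N} H a b.
Arguments rees_gr {K N} H d.

Section MultichainIdeals.
Variables (K : fieldType) (d : Order.disp_t) (P : finPOrderType d).
Variables (r n : nat) (p : 'I_n -> P).

(* The variable x_ij of S = K[x_ij : i < r, j < n], encoded as
   {mpoly K[r * n]} through the bijection mxvec_index : [r] x [n] -> [r * n]. *)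
Definition xvar (i : 'I_r) (j : 'I_n) : {mpoly K[r * n]} :=
  'X_(mxvec_index i j).

(* c encodes the sequence p_(c 0), ..., p_(c (r - 1)). *)
Definition multichain (c : 'I_r -> 'I_n) : Prop :=
  forall i i' : 'I_r, (i <= i')%N -> (p (c i) <= p (c i'))%O.

Definition multichain_monomial (c : 'I_r -> 'I_n) (A : {set 'I_r}) :
    {mpoly K[r * n]} :=
  \prod_(i in A) xvar i (c i).

Definition multichain_ideal (s : nat) : {pred {mpoly K[r * n]}} :=
  ideal_gen (fun f => `[< exists c (A : {set 'I_r}),
    [/\ multichain c, #|A| = s & f = multichain_monomial c A] >]).

Definition multichain_dual (s : nat) : {pred {mpoly K[r * n]}} :=
  alexander_dual (multichain_ideal s).

End MultichainIdeals.

Arguments multichain_ideal K {d P} r {n} p s.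
Arguments multichain_dual K {d P} r {n} p s.

(* Main.v *)
Require Import Defs.
From HB Require Import structures.
From mathcomp Require Import all_boot all_order all_algebra.
From mathcomp Require Import boolp mpoly zify ring.

Set Implicit Arguments.
Unset Strict Implicit.
Unset Printing Implicit Defensive.
Import GRing.Theory.

(** The Rees ring has a quadratic Groebner basis, and an algebra with a
    quadratic Groebner basis is Koszul.

    Generators of the dual ideal.  Put t = r - s + 1 and call the pairs
    (i, j) : [r] x [n] cells, j being a column.  The minimal primes of
    I_{r,s}(P) are generated by the minimal sets of cells that meet every
    multichain of s cells.  These are the sets a with exactly t cells in each
    column whose k-th cell moves weakly down the column as the column grows
    in P, for every k.  In terms of cum a c j, the number of cells of a among
    the first c rows of column j, this says that cum a r j = t and that
    cum a c j is antitone in j.  Such a set meets all chains because the rank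
    among the cells left out increases strictly along a chain that avoids a
    and takes only s - 1 values (isotone_meets_chains).  A set that meets all
    chains contains one of them, read off from the lengths of the longest
    chains outside it (meets_chains_isotone).  All of them have n * t cells.

    Standard monomials.  The Rees ring is spanned by the monomials in the
    variables x_v, v a cell, and T_a = u_a t, a an isotone set.  The products
    rewritten are
      T_a T_b -> T_a' T_b', where cum a' and cum b' are half of cum a + cum b
        rounded down and up (sort_exists);
      x_v T_a -> x_w T_b, where b is a with the cell w, the first one of a
        below v, moved up to v, if b is isotone (raise_exists).
    Both lower an additive weight: the second raises cum, and the first keeps
    the sum of the two functions cum and lowers a strictly convex function.
    A monomial containing no such pair is determined by its value in the Rees
    ring.  The sum of the functions cum over its T-factors is the greatest
    one possible, since otherwise some factor could be raised at the first
    place where another factorisation is ahead (csum_maximal); and a family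
    in which no two factors can be sorted consists of the roundings of its
    mean (all_sorted_unique).

    Resolution.  Let A have a basis of standard monomials, those avoiding a
    symmetric set of bad pairs of variables, each bad product being equal to
    a product of smaller weight.  In the resolution of K over A to be built,
    each basis element e_i of a free module carries a set Z_i of variables,
    so that the kernel of the differential meets the span of the e_i m, with
    m standard and prime to Z_i, only in 0.  For z in Z_i the product e_i z
    is then congruent modulo the kernel to a combination of smaller elements
    of this span, and the differences are the rows of the next matrix
    (step_mx).  Its entries are linear, its rows generate the kernel
    (step_exact), and the sets carried by the new basis elements, namely
    {z' in Z_i : z' < z} together with the variables bad for z, have the same
    property again (step_reduced, step_tail).  For A monomial this is the
    resolution that the linear quotients of ideals of variables provide; in
    general the weight, refined by the order of the basis elements, makes
    every reduction terminate. *)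

(** * Linear resolutions from quadratic standard monomials *)

Section StandardMonomials.

Local Open Scope ring_scope.

Variables (K : fieldType) (A : comAlgType K) (q : nat).
Variables (y : 'I_q -> A) (bad : rel 'I_q) (wt : 'I_q -> nat).
Variable cof : 'X_{1..q} -> {scalar A}.
Local Notation mon := 'X_{1..q}.

Implicit Types m : mon.

Local Notation ev := (mmap1 y).

Definition standard (m : mon) : bool :=
  [forall ij : 'I_q * 'I_q,
     (0 < m ij.1)%N ==> (0 < m ij.2)%N ==> ~~ bad ij.1 ij.2].

Definition weight (m : mon) : nat := (\sum_i wt i * m i)%N.

Hypothesis bad_sym : ssrbool.symmetric bad.
Hypothesis bad_irr : irreflexive bad.
Hypothesis bad_rewrite : forall i j, bad i j -> exists i' j',
  y i * y j = y i' * y j' /\ (wt i' + wt j' < wt i + wt j)%N.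
Hypothesis y_span : forall x : A, exists s : seq (K * mon),
  x = \sum_(z <- s) z.1 *: ev z.2.
Hypothesis cof_ev : forall m m', standard m -> standard m' ->
  cof m (ev m') = (m == m')%:R.

Lemma standardP m :
  reflect (forall i j, (0 < m i)%N -> (0 < m j)%N -> bad i j = false)
          (standard m).
Proof.
apply: (iffP forallP) => [h i j mi mj | h i].
  by have := h (i, j); rewrite mi mj /= => /negbTE.
by case: i => i j /=; apply/implyP => mi; apply/implyP => mj; rewrite h.
Qed.

Lemma mnm1_gt0 (i j : 'I_q) : (0 < U_(i)%MM j)%N = (i == j).
Proof. by rewrite mnm1E; case: eqP. Qed.

Lemma standard0 : standard 0%MM.
Proof. by apply/standardP => i j; rewrite mnm0E. Qed.

Lemma standardU i : standard U_(i)%MM.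
Proof. by apply/standardP => j k; rewrite !mnm1_gt0 => /eqP<- /eqP<-. Qed.

Lemma standardD1 i m : standard m ->
  (forall j, (0 < m j)%N -> bad i j = false) -> standard (U_(i) + m)%MM.
Proof.
move=> /standardP sm h; apply/standardP => j k; rewrite !mnmDE !addn_gt0 !mnm1_gt0.
move=> /orP[/eqP<-|mj] /orP[/eqP<-|mk]; rewrite ?bad_irr ?h //.
  by rewrite bad_sym h.
exact: sm.
Qed.

Lemma standardDr m m' : standard (m + m')%MM -> standard m'.
Proof.
move=> /standardP h; apply/standardP => i j mi mj.
by apply: h; rewrite mnmDE addn_gt0 ?mi ?mj orbT.
Qed.

Lemma weightD m m' : weight (m + m')%MM = (weight m + weight m')%N.
Proof.
by rewrite /weight -big_split /=; apply: eq_bigr => i _; rewrite mnmDE mulnDr.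
Qed.

Lemma weightU i : weight U_(i)%MM = wt i.
Proof.
rewrite /weight (bigD1 i) //= mnm1E eqxx muln1 big1 ?addn0 // => j ji.
by rewrite mnm1E eq_sym (negbTE ji) muln0.
Qed.

Lemma evD m m' : ev (m + m')%MM = ev m * ev m'.
Proof.
rewrite /mmap1 -big_split /=; apply: eq_bigr => i _.
by rewrite mnmDE exprD.
Qed.

Lemma evU i : ev U_(i)%MM = y i.
Proof. exact: mmap1U. Qed.

Lemma ev0 : ev 0%MM = 1.
Proof. exact: mmap11. Qed.

Lemma mnm_split1 (m : mon) i : (0 < m i)%N -> m = (U_(i) + (m - U_(i)))%MM.
Proof.
move=> mi; apply/mnmP => j; rewrite mnmDE mnmBE mnm1E.
by case: eqP => [<-|_]; lia.
Qed.

(** Termination of the rewriting: the weight is additive, hence drops whenever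
    a bad pair is replaced inside a monomial. *)
Lemma ev_standard m : exists m', [/\ standard m', ev m' = ev m,
  mdeg m' = mdeg m & (weight m' <= weight m)%N].
Proof.
have [n] := ubnP (weight m); elim: n m => // n IH m wm.
have [sm|] := boolP (standard m); first by exists m.
rewrite negb_forall => /existsP[[i j]] /=.
rewrite !negb_imply => /and4P[mi mj nij _].
have [i' [j' [yE wl]]] := bad_rewrite nij.
pose m1 := (m - U_(i))%MM; pose m2 := (m1 - U_(j))%MM.
have m1j : (0 < m1 j)%N.
  rewrite /m1 mnmBE mnm1E; case: eqP => [ij|_]; last by rewrite subn0.
  by rewrite ij bad_irr in nij.
have mE : m = (U_(i) + (U_(j) + m2))%MM by rewrite -mnm_split1 // -mnm_split1.
have [|m' [sm' em' dm' wm']] := IH (U_(i') + (U_(j') + m2))%MM.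
  by move: wm; rewrite mE !weightD !weightU; lia.
exists m'; split=> //.
- by rewrite em' mE !evD !evU !mulrA yE.
- by rewrite dm' mE !mdegD !mdeg1.
- by apply: leq_trans wm' _; rewrite mE !weightD !weightU; lia.
Qed.

(** The functionals cof are dual to the standard monomials, so the coefficients
    of an expansion can be read off without choosing one. *)
Lemma standard_expand x : exists U : seq mon, [/\ uniq U, all standard U &
  x = \sum_(m <- U) cof m x *: ev m].
Proof.
have [s xE] := y_span x.
have {xE} [s' [as' xE]] : exists s' : seq (K * mon),
    all standard [seq z.2 | z <- s'] /\ x = \sum_(z <- s') z.1 *: ev z.2.
  rewrite xE; elim: s {x xE} => [|[c m] s [s' [as' sE]]].
    by exists [::]; rewrite !big_nil.
  have [m' [sm' em' _ _]] := ev_standard m.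
  by exists ((c, m') :: s'); rewrite /= sm' as' !big_cons sE em'.
exists (undup [seq z.2 | z <- s']); rewrite undup_uniq all_undup; split=> //.
set U := undup _.
have UE m : m \in U -> standard m by rewrite mem_undup => /(allP as').
transitivity (\sum_(z <- s') \sum_(m <- U) (z.1 * cof m (ev z.2)) *: ev m).
  rewrite xE big_seq [RHS]big_seq; apply: eq_bigr => z zs.
  have zU : z.2 \in U by rewrite mem_undup map_f.
  rewrite (bigD1_seq z.2) ?undup_uniq //= cof_ev ?UE // eqxx mulr1.
  rewrite big_seq_cond big1 ?addr0 // => m /andP[mU mz].
  by rewrite cof_ev ?UE // (negbTE mz) mulr0 scale0r.
rewrite exchange_big /=; apply: eq_bigr => m _; rewrite xE linear_sum /=.
by rewrite scaler_suml; apply: eq_bigr => z _; rewrite linearZ.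
Qed.

Definition rterm b (c : K) (m : mon) (i : 'I_b) : 'rV[A]_b :=
  (c *: ev m) *: delta_mx 0 i.

(** Conditions on a row are imposed on the pairs (i, m) with a nonzero
    coefficient; this makes them stable under linear combinations, and
    [supported_ind] reduces a linear claim to a single term. *)
Definition supported b (Q : 'I_b -> mon -> Prop) (v : 'rV[A]_b) : Prop :=
  forall i m, standard m -> cof m (v 0 i) != 0 -> Q i m.

Lemma rtermE b c m (i j : 'I_b) :
  rterm c m i 0 j = if i == j then c *: ev m else 0.
Proof. by rewrite !mxE eqxx eq_sym; case: eqP; rewrite ?mulr1 ?mulr0. Qed.

Lemma supported_ind b (Q : 'I_b -> mon -> Prop) (P : 'rV[A]_b -> Prop) :
  P 0 -> (forall u v, P u -> P v -> P (u + v)) ->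
  (forall c i m, standard m -> Q i m -> P (rterm c m i)) ->
  forall v, supported Q v -> P v.
Proof.
move=> P0 PD Pt v Qv.
have -> : v = \sum_i (v 0 i) *: delta_mx 0 i by rewrite {1}(row_sum_delta v).
elim/big_ind: _ => // i _.
have [U [_ sU vE]] := standard_expand (v 0 i); rewrite vE scaler_suml big_seq.
elim/big_ind: _ => // m mU.
have sm := allP sU _ mU.
have [c0|c0] := eqVneq (cof m (v 0 i)) 0; last exact: Pt (Qv _ _ sm c0).
by rewrite c0 scale0r scale0r.
Qed.

Lemma supported0 b (Q : 'I_b -> mon -> Prop) : supported Q 0.
Proof. by move=> i m _; rewrite mxE linear0 eqxx. Qed.

Lemma supportedD b (Q : 'I_b -> mon -> Prop) u v :
  supported Q u -> supported Q v -> supported Q (u + v).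
Proof.
move=> Qu Qv i m sm; rewrite mxE linearD /=.
have [u0|/Qu] := eqVneq (cof m (u 0 i)) 0; last by move=> h _; apply: h.
by rewrite u0 add0r; apply: Qv.
Qed.

Lemma supported_rterm b (Q : 'I_b -> mon -> Prop) c m i :
  standard m -> Q i m -> supported Q (rterm c m i).
Proof.
move=> sm Qim j m' sm'; rewrite rtermE; case: (i =P j) => [<-|_].
  rewrite linearZ /= cof_ev //; case: (m' =P m) => [-> //|_].
  by rewrite mulr0 eqxx.
by rewrite linear0 eqxx.
Qed.

Lemma supportedW b (Q Q' : 'I_b -> mon -> Prop) v :
  (forall i m, standard m -> Q i m -> Q' i m) -> supported Q v -> supported Q' v.
Proof. by move=> QQ' Qv i m sm /Qv - /(_ sm); apply: QQ'. Qed.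

Lemma supported_eq0 b (v : 'rV[A]_b) : supported (fun _ _ => False) v -> v = 0.
Proof.
apply: (supported_ind (P := fun v => v = 0)) => [//|u w /= u0 w0|//].
by rewrite u0 w0 addr0.
Qed.

(** Multiplication by a monomial: rewriting the products to standard monomials
    keeps the degree and does not raise the weight. *)
Lemma supported_mul b (Q Q' : 'I_b -> mon -> Prop) c m' v :
  (forall i m m'', Q i m -> mdeg m'' = (mdeg m' + mdeg m)%N ->
     (weight m'' <= weight m' + weight m)%N -> Q' i m'') ->
  supported Q v -> supported Q' ((c *: ev m') *: v).
Proof.
move=> QQ'.
apply: (supported_ind (P := fun v => supported Q' ((c *: ev m') *: v))) =>
  [|u w Hu Hw|c1 i m sm Qm].
- by rewrite scaler0; apply: supported0.
- by rewrite scalerDr; apply: supportedD.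
have [m'' [sm'' em'' dm'' wm'']] := ev_standard (m' + m)%MM.
have -> : (c *: ev m') *: rterm c1 m i = rterm (c * c1) m'' i.
  rewrite /rterm scalerA em'' evD -!scalerAl -scalerAr scalerA.
  by [].
apply: supported_rterm => //; apply: QQ' Qm _ _; first by rewrite dm'' mdegD.
by rewrite -weightD.
Qed.

Lemma supported_bounded b (f : 'I_b -> mon -> nat) v :
  exists n, supported (fun i m => (f i m < n)%N) v.
Proof.
have : supported (fun _ _ => True) v by [].
apply: (supported_ind (P := fun v => exists n,
  supported (fun i m => (f i m < n)%N) v)) => [|u w [nu Hu] [nw Hw]|c i m sm _].
- by exists 0%N; apply: supported0.
- by exists (maxn nu nw); apply: supportedD;
    [apply: supportedW Hu|apply: supportedW Hw] => i m _; rewrite leq_max => ->;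
    rewrite ?orbT.
by exists (f i m).+1; apply: supported_rterm.
Qed.

Definition reduced (Z : {set 'I_q}) m := [forall z in Z, m z == 0%N].

Lemma reducedP (Z : {set 'I_q}) m :
  reflect (forall z, z \in Z -> m z = 0%N) (reduced Z m).
Proof.
apply: (iffP forallP) => h z; first by move=> zZ; move: (h z); rewrite zZ => /eqP.
by apply/implyP => /h/eqP.
Qed.

(** The order that makes reductions terminate: first the weight of the
    monomial plus that of the basis element, then the position of the basis
    element, both encoded in one number.  Multiplying two terms by the same
    monomial shifts both keys equally. *)
Definition key b (O : nat) (kp : 'I_b -> nat) (i : 'I_b) m : nat :=
  (O * weight m + kp i)%N.

(** One step of the resolution.  [Ker] is the kernel of the previous
    differential; [tl i z] is the combination of smaller terms to which
    [e_i z] reduces modulo [Ker]. *)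
Section Step.

Variables (b : nat) (Z : 'I_b -> {set 'I_q}) (O : nat) (kp : 'I_b -> nat).
Variables (Ker : 'rV[A]_b -> Prop) (tl : 'I_b -> 'I_q -> 'rV[A]_b).
Local Notation key1 := (key O kp).

Hypothesis O_gt0 : (0 < O)%N.
Hypothesis Ker_lin : forall a u v, Ker u -> Ker v -> Ker (a *: u + v).
Hypothesis Ker0 : Ker 0.
Hypothesis Ker_reduced : forall v, Ker v ->
  supported (fun i m => reduced (Z i) m) v -> v = 0.
Hypothesis tl_ker : forall i z, z \in Z i ->
  Ker (y z *: delta_mx 0 i - tl i z).
Hypothesis tl_supp : forall i z, z \in Z i ->
  supported (fun j m => [/\ reduced (Z j) m, mdeg m = 1%N &
    (key1 j m < key1 i U_(z)%MM)%N]) (tl i z).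

Definition step_index : {set 'I_b * 'I_q} := [set x | x.2 \in Z x.1].
Local Notation b' := #|step_index|.
Definition step_src (k : 'I_b') : 'I_b := (enum_val k).1.
Definition step_var (k : 'I_b') : 'I_q := (enum_val k).2.

Definition step_mx : 'M[A]_(b', b) := \matrix_(k < b')
  (y (step_var k) *: delta_mx 0 (step_src k) - tl (step_src k) (step_var k)).

Definition step_set (k : 'I_b') : {set 'I_q} :=
  [set z | (z \in Z (step_src k)) && (z < step_var k)%N || bad (step_var k) z].

Definition step_key (k : 'I_b') : nat :=
  (q.+1 * key1 (step_src k) U_(step_var k)%MM + step_var k)%N.

Local Notation key2 := (key (q.+1 * O)%N step_key).
Local Notation lead k m := (key1 (step_src k) (U_(step_var k) + m)%MM).

(** The new order refines the order of the leading terms lexicographically, as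
    step_var k < q.+1. *)
Lemma key2E k m : key2 k m = (q.+1 * lead k m + step_var k)%N.
Proof. by rewrite /key /step_key /key weightD weightU; ring. Qed.

Lemma step_in k : step_var k \in Z (step_src k).
Proof. by have := enum_valP k; rewrite inE. Qed.

Lemma step_exists i z : z \in Z i ->
  exists k, step_src k = i /\ step_var k = z.
Proof.
move=> zi; have iz : (i, z) \in step_index by rewrite inE.
by exists (enum_rank_in iz (i, z)); rewrite /step_src /step_var enum_rankK_in.
Qed.

Lemma step_inj k k' :
  step_src k = step_src k' -> step_var k = step_var k' -> k = k'.
Proof.
rewrite /step_src /step_var => e1 e2; apply: enum_val_inj.
by rewrite [LHS]surjective_pairing e1 e2 -surjective_pairing.
Qed.

Lemma step_std k m :
  standard m -> reduced (step_set k) m -> standard (U_(step_var k) + m)%MM.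
Proof.
move=> sm /reducedP rm; apply: standardD1 => // j mj; apply/negP => kj.
by move: mj; rewrite rm // inE kj orbT.
Qed.

(** A standard monomial not prime to [Z i] has a least variable in [Z i], and
    the cofactor is prime to the set carried by the corresponding new basis
    element: this is why that set contains the smaller elements of [Z i]. *)
Lemma step_split i m : standard m -> ~~ reduced (Z i) m ->
  exists k m', [/\ step_src k = i, m = (U_(step_var k) + m')%MM,
    standard m' & reduced (step_set k) m'].
Proof.
move=> sm /forallPn[z0]; rewrite negb_imply -lt0n => /andP[z0Z mz0].
pose z := [arg min_(z < z0 | (z \in Z i) && (0 < m z)%N) (z : nat)]%N.
have : (z \in Z i) /\ ((0 < m z)%N /\ forall z', z' \in Z i -> (0 < m z')%N -> (z <= z')%N).
  rewrite /z; case: arg_minnP => [|z1 /andP[? ?] h]; first by rewrite z0Z.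
  split=> //; split=> // z' ? ?.
  by apply: h; apply/andP.
move: (z) => {}z [zZ [mz zmin]].
have [k [ki kz]] := step_exists zZ.
have mE := mnm_split1 mz; exists k, (m - U_(z))%MM; rewrite kz; split=> //.
  by apply: standardDr (_ : standard (U_(z) + _)%MM); rewrite -mE.
apply/reducedP => w; rewrite inE ki kz mnmBE mnm1E.
have [mw|] := posnP (m w); first by rewrite mw.
move=> mw /orP[/andP[wZ wz]|zw]; first by have := zmin _ wZ mw; lia.
by move/standardP: sm => /(_ _ _ mz mw); rewrite zw.
Qed.

(** The converse of [step_split]: the least variable in [Z i] recovers the new
    basis element from the leading term. *)
Lemma reduced_step_unique k k' m m' : step_src k = step_src k' ->
  reduced (step_set k) m -> reduced (step_set k') m' ->
  (U_(step_var k) + m = U_(step_var k') + m')%MM -> k = k' /\ m = m'.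
Proof.
move=> ks /reducedP rm /reducedP rm' e.
have main (k1 k2 : 'I_b') m1 m2 : step_src k1 = step_src k2 ->
    (forall z, z \in step_set k1 -> m1 z = 0%N) ->
    (U_(step_var k1) + m1 = U_(step_var k2) + m2)%MM ->
    (step_var k1 <= step_var k2)%N.
  move=> s12 r1 e12; rewrite leqNgt; apply/negP => lt.
  have := congr1 (fun m : mon => m (step_var k2)) e12.
  rewrite !mnmDE !mnm1E eqxx r1 ?addn0; last by rewrite inE s12 step_in lt.
  by case: eqP => // /(congr1 val) /=; lia.
have kv : step_var k = step_var k'.
  by apply/val_inj/eqP; rewrite eqn_leq (main _ _ _ _ ks rm e)
     (main _ _ _ _ (esym ks) rm' (esym e)).
by split; [apply: step_inj|move: e; rewrite kv => /addmI].
Qed.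

Lemma row_step k : delta_mx 0 k *m step_mx =
  y (step_var k) *: delta_mx 0 (step_src k) - tl (step_src k) (step_var k).
Proof. by rewrite -rowE rowK. Qed.

Lemma rterm_step c m k : rterm c m k *m step_mx =
  rterm c (U_(step_var k) + m)%MM (step_src k)
  - (c *: ev m) *: tl (step_src k) (step_var k).
Proof.
rewrite /rterm -scalemxAl row_step scalerBr scalerA evD evU.
by rewrite -scalerAl [ev m * _]mulrC.
Qed.

Lemma tail_mul c m k (T : nat -> Prop) n : T (mdeg m).+1 ->
  (lead k m <= n)%N ->
  supported (fun j m' => T (mdeg m') /\ (key1 j m' < n)%N)
    ((c *: ev m) *: tl (step_src k) (step_var k)).
Proof.
move=> Tm kn; apply: supported_mul (tl_supp (step_in k)) => j m1 m2 [_ d1 lt] -> wl.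
split; first by rewrite d1 addn1.
apply: leq_trans kn; move: lt; rewrite /key weightD.
have /(leq_mul (leqnn O)) := wl; lia.
Qed.

(** Division of a row by the rows of the next matrix.  [T] carries along the
    degree, which is needed to keep the tails of the next step linear. *)
Lemma step_reduce (T : nat -> Prop) n v :
  supported (fun i m => T (mdeg m) /\ (key1 i m < n)%N) v ->
  exists h : 'rV[A]_b',
    supported (fun i m => reduced (Z i) m) (v - h *m step_mx) /\
    supported (fun k m => [/\ reduced (step_set k) m, T (mdeg m).+1 &
      (lead k m < n)%N]) h.
Proof.
elim: n v => [|n IH] v.
  move=> Hv; have -> : v = 0.
    by apply: supported_eq0; apply: supportedW Hv => i m _ [].
  by exists 0; rewrite mul0mx subr0; split; apply: supported0.
pose concl w := exists h : 'rV[A]_b',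
    supported (fun i m => reduced (Z i) m) (w - h *m step_mx) /\
    supported (fun k m => [/\ reduced (step_set k) m, T (mdeg m).+1 &
      (lead k m < n.+1)%N]) h.
apply: (supported_ind (P := concl)) => [|u w [hu [u1 u2]] [hw [w1 w2]]|c i m sm [Tm kn]].
- by exists 0; rewrite mul0mx subr0; split; apply: supported0.
- exists (hu + hw); split; last exact: supportedD.
  by rewrite mulmxDl opprD addrACA; apply: supportedD.
have [rm|nrm] := boolP (reduced (Z i) m).
  exists 0; rewrite mul0mx subr0; split; last exact: supported0.
  exact: supported_rterm.
have [k [m' [ki mE sm' rm']]] := step_split sm nrm; subst i.
have [|h [h1 h2]] := IH ((c *: ev m') *: tl (step_src k) (step_var k)).
  by apply: tail_mul; [rewrite -[_.+1]add1n -(mdeg1 (step_var k)) -mdegD -mE|rewrite -mE].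
exists (rterm c m' k + h); split.
  by rewrite mulmxDl rterm_step -mE opprD opprB addrA addrCA subrr addr0.
apply: supportedD.
  by apply: supported_rterm; rewrite // -mE; split=> //; move: Tm; rewrite mE mdegD mdeg1.
by apply: supportedW h2 => k' m1 _ [? ? ?]; split=> //; apply: ltnW.
Qed.

Lemma Ker_step h : Ker (h *m step_mx).
Proof.
rewrite mulmx_sum_row; elim/big_rec: _ => // k v _ Kv.
by apply: Ker_lin => //; rewrite rowK; apply: tl_ker; apply: step_in.
Qed.

Lemma Ker_sub u v : Ker u -> Ker v -> Ker (u - v).
Proof. by move=> Ku Kv; rewrite addrC -scaleN1r; apply: Ker_lin. Qed.

(** The remainder of the division of an element of [Ker] is an element of [Ker]
    in reduced position, hence 0. *)
Lemma step_exact v : Ker v <-> exists w, v = w *m step_mx.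
Proof.
split=> [Kv|[w ->]]; last exact: Ker_step.
have [n Hn] := supported_bounded (key O kp) v.
have [|h [h1 _]] := step_reduce (T := fun _ => True) (n := n) (v := v).
  by apply: supportedW Hn.
exists h; apply/eqP; rewrite -subr_eq0; apply/eqP.
by apply: Ker_reduced => //; apply: Ker_sub => //; apply: Ker_step.
Qed.

(** Leading terms of distinct reduced terms are distinct and cannot be
    cancelled by the tails, which are smaller. *)
Lemma step_reduced (v : 'rV[A]_b') : v *m step_mx = 0 ->
  supported (fun k m => reduced (step_set k) m) v -> v = 0.
Proof.
move=> v0 rv; have [n lv] := supported_bounded (fun k m => lead k m) v.
have {rv lv} : supported (fun k m => reduced (step_set k) m /\ (lead k m < n)%N) v.
  by move=> k m sm cm; split; [apply: rv | apply: lv].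
elim: n => [|n IH] Hv; first by apply: supported_eq0; apply: supportedW Hv => k m _ [].
apply: IH => k m sm cm; have [rm] := Hv k m sm cm.
rewrite ltnS leq_eqVlt => /orP[/eqP lm|]; last by [].
case/negP: cm; apply/eqP.
(* The coefficient of v at a largest leading term survives in v *m step_mx. *)
suff <- : cof (U_(step_var k) + m)%MM ((v *m step_mx) 0 (step_src k)) = cof m (v 0 k).
  by rewrite v0 mxE linear0.
pose P (u : 'rV[A]_b') :=
  cof (U_(step_var k) + m)%MM ((u *m step_mx) 0 (step_src k)) = cof m (u 0 k).
suff: P v by [].
move: Hv; apply: (supported_ind (P := P)) => [|u w Hu Hw|c k' m' sm' [rm' lm']].
- by rewrite /P mul0mx !mxE !linear0.
- by rewrite /P mulmxDl [in LHS]mxE [in RHS]mxE !linearD /= Hu Hw.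
have lt0 : cof (U_(step_var k) + m)%MM
    (((c *: ev m') *: tl (step_src k') (step_var k')) 0 (step_src k)) = 0.
  apply/eqP; apply: contraT => nz.
  have [_] := tail_mul (T := fun _ => True) (c := c) (m := m') (k := k') I
    (leqnn _) (step_std sm rm) nz.
  by rewrite lm ltnNge -ltnS lm'.
rewrite /P rterm_step mxE [X in _ + X]mxE linearB /= lt0 subr0 !rtermE.
have [ks|ks] := eqVneq (step_src k') (step_src k); last first.
  rewrite linear0; case: (k' =P k) => [kk|_]; last by rewrite linear0.
  by rewrite kk eqxx in ks.
rewrite linearZ /= cof_ev; [|exact: step_std..].
have [e|ne] := eqVneq (U_(step_var k) + m)%MM (U_(step_var k') + m')%MM.
  have [-> ->] := reduced_step_unique (esym ks) rm rm' e.
  by rewrite eqxx linearZ /= cof_ev // eqxx.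
rewrite mulr0; case: (k' =P k) => [kk|_]; last by rewrite linear0.
rewrite linearZ /= cof_ev //; case: (m =P m') => [mm|_]; last by rewrite mulr0.
by rewrite mm kk eqxx in ne.
Qed.

(** The relation [e_k w] of the next step is either a rewriting of a bad product
    or the exchange of two variables [z > w] of [Z i]; dividing its image by
    the rows of the matrix leaves a remainder in [Ker], which vanishes. *)
Lemma step_tail k w : w \in step_set k -> exists h : 'rV[A]_b',
  (y w *: delta_mx 0 k - h) *m step_mx = 0 /\
  supported (fun j m => [/\ reduced (step_set j) m, mdeg m = 1%N &
    (key2 j m < key2 k U_(w)%MM)%N]) h.
Proof.
move=> wk; set i := step_src k; set z := step_var k.
pose n := key1 i (U_(z) + U_(w))%MM.
(* A smaller leading term is smaller in the new order, as step_var j <= q. *)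
have fine j m : (lead j m < n)%N -> (key2 j m < key2 k U_(w)%MM)%N.
  move=> lt; rewrite !key2E -/i -/z -/n; have := ltn_ord (step_var j).
  have := leq_mul (leqnn q.+1) lt; rewrite mulnS; lia.
pose T d := d = 2%N.
pose good (u : 'rV[A]_b) := exists h : 'rV[A]_b',
  supported (fun i m => reduced (Z i) m) (u - h *m step_mx) /\
  supported (fun j m => [/\ reduced (step_set j) m, mdeg m = 1%N &
    (key2 j m < key2 k U_(w)%MM)%N]) h.
have goodD u v : good u -> good v -> good (u + v).
  move=> [h [h1 h2]] [h' [h1' h2']]; exists (h + h'); split.
    by rewrite mulmxDl opprD addrACA; apply: supportedD.
  exact: supportedD.
have goodN u : good u -> good (- u).
  move=> [h [h1 h2]]; exists (- h); split => [|j m sm].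
    by rewrite mulNmx -opprD => j m sm; rewrite mxE linearN oppr_eq0; apply: h1.
  by rewrite mxE linearN oppr_eq0; apply: h2.
have low u : supported (fun j m => T (mdeg m) /\ (key1 j m < n)%N) u -> good u.
  move=> /step_reduce[h [h1 h2]]; exists h; split=> //.
  by apply: supportedW h2 => j m _ [? [?] ?]; split=> //; apply: fine.
have tail1 k' z' : step_src k' = i ->
    key1 i (U_(step_var k') + U_(z'))%MM = n ->
    good (- (y z' *: tl i (step_var k'))).
  move=> ki kn; apply/goodN/low; rewrite -(evU z') -[ev _]scale1r -ki.
  by apply: tail_mul; [rewrite /T mdeg1|rewrite ki kn].
have : good ((y w *: delta_mx 0 k) *m step_mx).
  rewrite -scalemxAl row_step scalerBr -/i -/z scalerA; apply: (goodD); last exact: tail1.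
  have : w \in step_set k by [].
  rewrite inE; have [zw _|nzw] := boolP (bad (step_var k) w).
    apply: low; have [i' [j' [yE wl]]] := bad_rewrite zw.
    have [m [sm em dm wm]] := ev_standard (U_(i') + U_(j'))%MM.
    have -> : (y w * y z) *: delta_mx 0 i = rterm 1 m i.
      by rewrite /rterm scale1r em evD !evU -yE mulrC.
    apply: supported_rterm => //; split; first by rewrite /T dm mdegD !mdeg1.
    rewrite /n /key ltn_add2r ltn_mul2l O_gt0 /=; apply: leq_ltn_trans wm _.
    by rewrite !weightD !weightU.
  (* w and z are both in Z i and w < z: the new basis element of (i, w) takes
     the leading term over. *)
  rewrite orbF => /andP[wZ wz].
  have [k' [ki kw]] := step_exists wZ.
  have -> : (y w * y z) *: delta_mx 0 i =
      rterm 1 U_(z)%MM k' *m step_mx + y z *: tl i w.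
    by rewrite rterm_step ki kw /rterm !scale1r evD !evU subrK.
  apply: (goodD); last first.
    rewrite -[_ *: _]opprK -kw; apply/goodN/tail1 => //.
    by rewrite kw addmC.
  exists (rterm 1 U_(z)%MM k'); rewrite subrr; split; first exact: supported0.
  apply: supported_rterm; rewrite ?standardU //; split; last 1 first.
  - by rewrite !key2E ki kw -/i -/z addmC ltn_add2l.
  - apply/reducedP => x; rewrite inE ki kw mnm1E.
    case: eqP => // <- /orP[/andP[_ zw]|].
      by move: wz; rewrite ltnNge (ltnW zw).
    by rewrite bad_sym (negbTE nzw).
  by rewrite mdeg1.
case=> h [h1 h2]; exists h; split=> //.
rewrite mulmxBl; apply: Ker_reduced => //.
by apply: Ker_sub; apply: Ker_step.
Qed.

End Step.

(** A free module of the resolution with its bookkeeping: [stage_mult] and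
    [stage_key] are the two parameters of [key], [stage_ker] is the kernel of
    the differential that starts there. *)
Record stage := Stage {
  stage_size : nat;
  stage_set : 'I_stage_size -> {set 'I_q};
  stage_mult : nat;
  stage_key : 'I_stage_size -> nat;
  stage_ker : 'rV[A]_stage_size -> Prop }.

Arguments stage_set : clear implicits.
Arguments stage_key : clear implicits.
Arguments stage_ker : clear implicits.

Record stage_good (st : stage) : Prop := StageGood {
  _ : (0 < stage_mult st)%N;
  _ : forall a u v, stage_ker st u -> stage_ker st v -> stage_ker st (a *: u + v);
  _ : stage_ker st 0;
  _ : forall v, stage_ker st v ->
      supported (fun i m => reduced (stage_set st i) m) v -> v = 0;
  _ : forall i z, z \in stage_set st i -> exists f,
      stage_ker st (y z *: delta_mx 0 i - f) /\
      supported (fun j m => [/\ reduced (stage_set st j) m, mdeg m = 1%N &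
        (key (stage_mult st) (stage_key st) j m <
         key (stage_mult st) (stage_key st) i U_(z)%MM)%N]) f }.

Variable gr : nat -> {pred A}.
Hypothesis gr_cof : forall d x, x \in gr d <->
  forall m, standard m -> cof m x != 0 -> mdeg m = d.

Lemma gr_submod d : submod_closed (gr d).
Proof.
split=> [|a u v /gr_cof Hu /gr_cof Hv]; apply/gr_cof => m sm.
  by rewrite linear0 eqxx.
have [u0|u0] := eqVneq (cof m u) 0; last by move=> _; apply: Hu u0.
by rewrite linearP u0 mulr0 add0r; apply: Hv.
Qed.

Lemma gr_ind d (P : A -> Prop) :
  P 0 -> (forall u v, P u -> P v -> P (u + v)) ->
  (forall c m, standard m -> mdeg m = d -> P (c *: ev m)) ->
  forall x, x \in gr d -> P x.
Proof.
move=> P0 PD Pt x /gr_cof xd; have [U [_ sU ->]] := standard_expand x.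
rewrite big_seq; elim/big_ind: _ => // m mU.
have sm := allP sU _ mU; have [->|c0] := eqVneq (cof m x) 0; first by rewrite scale0r.
by apply: Pt => //; apply: xd.
Qed.

Lemma ev_gr m : ev m \in gr (mdeg m).
Proof.
have [m' [sm' <- <- _]] := ev_standard m; apply/gr_cof => m1 sm1.
by rewrite cof_ev //; case: (m1 =P m') => [-> //|_]; rewrite eqxx.
Qed.

Lemma grZ d c x : x \in gr d -> c *: x \in gr d.
Proof.
by move=> xd; have [g0 /(_ c x 0 xd g0)] := gr_submod d; rewrite addr0.
Qed.

Lemma grD d x x' : x \in gr d -> x' \in gr d -> x + x' \in gr d.
Proof. by move=> xd xd'; have [_ /(_ 1 x x' xd xd')] := gr_submod d; rewrite scale1r. Qed.

Lemma gr0 d : 0 \in gr d.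
Proof. by case: (gr_submod d). Qed.

Lemma pbw_graded_algebra : graded_algebra gr.
Proof.
split.
- exact: gr_submod.
- by rewrite -ev0 -(mdeg0 (n := q)); apply: ev_gr.
- move=> i j x x' xi; move: x'; apply: gr_ind => [|u v Hu Hv|c m sm <-].
  + by rewrite mulr0 gr0.
  + by rewrite mulrDr grD.
  move: x xi; apply: gr_ind => [|u v Hu Hv|c' m' sm' <-].
  + by rewrite mul0r gr0.
  + by rewrite mulrDl grD.
  by rewrite -scalerAl -scalerAr -evD -mdegD !grZ ?ev_gr.
- move=> x; have [U [_ sU xE]] := standard_expand x.
  exists (\max_(m <- U) mdeg m).+1.
  exists (fun i => \sum_(m <- U | mdeg m == i) cof m x *: ev m); split.
    move=> i; elim/big_ind: _ => [||m /eqP<-]; rewrite ?gr0 ?grZ ?ev_gr //.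
    exact: grD.
  rewrite [LHS]xE (exchange_big_dep xpredT) //= big_seq [RHS]big_seq.
  apply: eq_bigr => m mU.
  have lt : (mdeg m < (\max_(m0 <- U) mdeg m0).+1)%N by rewrite ltnS leq_bigmax_seq.
  rewrite (eq_bigl (pred1 (Ordinal lt))) ?big_pred1_eq //.
move=> n f fg s0 i lti.
have [U [_ sU ->]] := standard_expand (f i).
rewrite big_seq big1 // => m mU; have sm := allP sU _ mU.
have [->|c0] := eqVneq (cof m (f i)) 0; first by rewrite scale0r.
have mi := proj1 (gr_cof _ _) (fg i) m sm c0.
have := congr1 (cof m) s0; rewrite linear0 linear_sum /= (bigD1 (Ordinal lti)) //=.
rewrite big1 ?addr0 => [->|j ji]; first by rewrite scale0r.
apply/eqP; apply: contraT => cj.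
have mj := proj1 (gr_cof _ _) (fg j) m sm cj.
by move: ji; rewrite -val_eqE /= -mj mi eqxx.
Qed.

Lemma ev_prod_tuple m : exists t : (mdeg m).-tuple A,
  {subset t <= codom y} /\ ev m = \prod_(x <- t) x.
Proof.
have [d] := ubnP (mdeg m); elim: d m => // d IH m md.
have [m0|] := posnP (mdeg m).
  have {}m0 : m = 0%MM by apply/eqP; rewrite -mdeg_eq0 m0.
  rewrite m0 mdeg0; exists [tuple]; rewrite big_nil ev0; split=> //.
move=> m_gt0; have [i mi] : exists i, (0 < m i)%N.
  apply/existsP; apply: contraTT m_gt0 => /existsPn h.
  by rewrite -leqNgt mdegE big1 // => i _; have := h i; rewrite lt0n negbK => /eqP.
move: md; rewrite (mnm_split1 mi) mdegD mdeg1 add1n ltnS => md.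
have [t [tc tE]] := IH _ md; exists [tuple of y i :: t].
rewrite big_cons evD evU tE; split=> // x; rewrite inE => /orP[/eqP->|/tc //].
exact: codom_f.
Qed.

Lemma pbw_standard_graded : standard_graded gr.
Proof.
split; first exact: pbw_graded_algebra.
  move=> x; split => [|[c ->]]; last by apply: grZ; rewrite -ev0 -(mdeg0 (n := q)) ev_gr.
  move: x; apply: gr_ind => [|u v [a ->] [c ->]|c m sm /eqP].
  - by exists 0; rewrite scale0r.
  - by exists (a + c); rewrite scalerDl.
  by rewrite mdeg_eq0 => /eqP->; exists c; rewrite ev0.
exists (codom y); split=> [_ /codomP[i ->]|i].
  by rewrite -evU -(mdeg1 i) ev_gr.
move=> x; move: x; apply: gr_ind => [|u v /asboolP[s [sG ->]] /asboolP[s' [sG' ->]]|c m sm md].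
- by apply/asboolP; exists [::]; rewrite big_nil.
- apply/asboolP; exists (s ++ s'); rewrite big_cat; split=> // z.
  by rewrite map_cat mem_cat => /orP[/sG|/sG'].
apply/asboolP; exists [:: (c, ev m)]; rewrite big_seq1; split=> // z.
rewrite inE => /eqP->; apply/asboolP; rewrite -md; exact: ev_prod_tuple.
Qed.

(** The augmentation is the coefficient of the empty monomial. *)
Lemma irrelevant_cof x : x \in irrelevant_ideal gr <-> cof 0%MM x = 0.
Proof.
split=> [/asboolP[n [f [fg ->]]]|c0].
  rewrite linear_sum /= big1 // => i _; apply/eqP; apply: contraT => ci.
  by have := proj1 (gr_cof _ _) (fg i) _ standard0 ci; rewrite mdeg0.
have [_ _ _ decomp _] := pbw_graded_algebra.
have [n [f [fg xE]]] := decomp x.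
apply/asboolP; exists n, (fun i => if (i.+1 < n)%N then f i.+1 else 0); split.
  by move=> i; case: ifP => _; rewrite ?fg ?gr0.
have f0 : (0 < n)%N -> f 0%N = 0.
  move=> n_gt0; have [c fE] : exists c, f 0%N = c%:A.
    by have [_ h _] := pbw_standard_graded; apply/h.
  suff: cof 0%MM (f 0%N) = 0.
    by rewrite fE linearZ /= -ev0 cof_ev ?standard0 // eqxx mulr1 => ->; rewrite scale0r.
  rewrite -c0 xE linear_sum /= (bigD1 (Ordinal n_gt0)) //= big1 ?addr0 // => i i0.
  apply/eqP; apply: contraT => ci; move: i0; rewrite -val_eqE /=.
  by have := proj1 (gr_cof _ _) (fg i) _ standard0 ci; rewrite mdeg0 => <-.
rewrite {}xE; case: n f0 => [|n] f0; first by rewrite !big_ord0.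
rewrite big_ord_recl big_ord_recr /= ltnn addr0 f0 // add0r.
by apply: eq_bigr => i _; rewrite ltnS ltn_ord.
Qed.

(** The resolution starts from A itself, with all the variables in the set
    carried by its generator and the augmentation ideal as the kernel. *)
Definition stage0 : stage := @Stage 1 (fun _ => [set: 'I_q]) 1 (fun _ => 0%N)
  (fun v => forall k l, v k l \in irrelevant_ideal gr).

Lemma stage0_good : stage_good stage0.
Proof.
split=> //=.
- move=> a u v Hu Hv k l; rewrite !mxE; apply/irrelevant_cof.
  rewrite linearD /= (proj1 (irrelevant_cof _) (Hv k l)) addr0.
  move: (u k l) (Hu k l) => {Hv u v Hu} x /irrelevant_cof x0.
  have [U [_ sU ->]] := standard_expand x.
  have [V [_ sV ->]] := standard_expand a.
  rewrite mulr_suml linear_sum /= big1 // => m _; rewrite mulr_sumr linear_sum /=.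
  rewrite big1_seq // => m' /andP[_ m'U].
  have [->|m'0] := eqVneq m' 0%MM; first by rewrite x0 scale0r mulr0 linear0.
  rewrite -scalerAl -scalerAr -evD !linearZ /=.
  have [m1 [sm1 <- dm1 _]] := ev_standard (m + m')%MM.
  rewrite cof_ev ?standard0 // eq_sym -mdeg_eq0 dm1 mdegD addn_eq0 !mdeg_eq0.
  by rewrite (negbTE m'0) andbF !mulr0.
- by move=> k l; rewrite mxE; apply/irrelevant_cof; rewrite linear0.
- move=> v Kv rv; apply: supported_eq0 => i m sm cm.
  have /reducedP m0 := rv i m sm cm.
  have {}m0 : m = 0%MM by apply/mnmP => z; rewrite m0 ?inE // mnm0E.
  by case/negP: cm; rewrite m0; apply/eqP/irrelevant_cof.
move=> i z _; exists 0; split; last exact: supported0.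
move=> k l; rewrite subr0 !mxE; apply/irrelevant_cof.
have yz0 : cof 0%MM (y z) = 0.
  by rewrite -evU cof_ev ?standard0 ?standardU // eq_sym mnm1_eq0.
by case: (_ && _); rewrite ?mulr1 ?mulr0 ?linear0.
Qed.

Lemma stage_next (st : stage) : stage_good st ->
  exists st' (D : 'M[A]_(stage_size st', stage_size st)), [/\ stage_good st',
    forall k l, D k l \in gr 1,
    forall v, stage_ker st v <-> exists w, v = w *m D &
    forall w, stage_ker st' w <-> w *m D = 0].
Proof.
case: st => b Z O kp Ker [/= O_gt0 Ker_lin Ker0 Ker_red Ker_tl].
have [tl tlP] : exists tl : 'I_b -> 'I_q -> 'rV[A]_b, forall i z, z \in Z i ->
    Ker (y z *: delta_mx 0 i - tl i z) /\
    supported (fun j m => [/\ reduced (Z j) m, mdeg m = 1%N &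
    (key O kp j m < key O kp i U_(z)%MM)%N]) (tl i z).
  have h (iz : 'I_b * 'I_q) : exists f, iz.2 \in Z iz.1 ->
      Ker (y iz.2 *: delta_mx 0 iz.1 - f) /\
      supported (fun j m => [/\ reduced (Z j) m, mdeg m = 1%N &
      (key O kp j m < key O kp iz.1 U_(iz.2)%MM)%N]) f.
    have [/Ker_tl[f fP]|] := boolP (iz.2 \in Z iz.1); first by exists f.
    by exists 0.
  have [tl tlP] := choice h.
  by exists (fun i z => tl (i, z)) => i z; apply: (tlP (i, z)).
have tl_ker i z (zi : z \in Z i) := proj1 (tlP i z zi).
have tl_supp i z (zi : z \in Z i) := proj2 (tlP i z zi).
exists (@Stage #|step_index Z| (@step_set b Z) (q.+1 * O) (@step_key b Z O kp)
  (fun w => w *m step_mx Z tl = 0)).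
exists (step_mx Z tl); split=> //=.
- split=> /= [||||k z zk].
  + by rewrite muln_gt0.
  + by move=> a u v u0 v0; rewrite mulmxDl -scalemxAl u0 v0 scaler0 addr0.
  + by rewrite mul0mx.
  + exact: step_reduced tl_supp.
  have [h [h1 h2]] := step_tail O_gt0 Ker_lin Ker0 Ker_red tl_ker tl_supp zk.
  by exists h.
- move=> k l; rewrite !mxE; have ki := step_in k.
  have tg : tl (step_src k) (step_var k) 0 l \in gr 1.
    by apply/gr_cof => m sm cm; have [] := tl_supp _ _ ki l m sm cm.
  have yg : y (step_var k) \in gr 1 by rewrite -evU -(mdeg1 (step_var k)) ev_gr.
  rewrite -[- tl _ _ _ _]scaleN1r grD ?grZ //; case: (_ && _); by rewrite ?mulr1 ?mulr0 ?gr0.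
- by move=> v; apply: step_exact tl_supp v.
Qed.

Lemma pbw_linear_resolution : linear_resolution gr.
Proof.
pose good := {st : stage | stage_good st}.
have next (g : good) : {g' : good & {D : 'M[A]_(stage_size (sval g'), stage_size (sval g)) |
    [/\ forall k l, D k l \in gr 1,
    forall v, stage_ker (sval g) v <-> exists w, v = w *m D &
    forall w, stage_ker (sval g') w <-> w *m D = 0]}}.
  case: g => st g; have [st' /cid[D [g' D1 D2 D3]]] := cid (stage_next g).
  by exists (exist _ st' g'), D.
pose g0 : good := exist _ stage0 stage0_good.
pose g := nat_rect (fun _ => good) g0 (fun _ g => projT1 (next g)).
exists (fun i => stage_size (sval (g i))), (fun i => sval (projT2 (next (g i)))).
split=> //.
- by move=> i; case: (svalP (projT2 (next (g i)))).
- move=> v; case: (svalP (projT2 (next (g 0%N)))) => _ h _.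
  by apply: (iff_trans (iff_sym (h v))).
move=> i v; case: (svalP (projT2 (next (g i)))) => _ _ h.
apply: (iff_trans (iff_sym (h v))).
by case: (svalP (projT2 (next (g i.+1)))) => _ h' _; apply: h'.
Qed.

Theorem pbw_koszul : koszul gr.
Proof.
split; [exact: pbw_standard_graded | exact: pbw_linear_resolution].
Qed.

End StandardMonomials.

(** * Rees rings of equigenerated monomial ideals *)

Section MonomialRees.

Local Open Scope ring_scope.

Variables (K : fieldType) (N : nat) (H : {pred {mpoly K[N]}}).
Variables (L : finType) (u : L -> 'X_{1..N}) (delta : nat).
Local Notation S := {mpoly K[N]}.
Local Notation Y := ('I_N + L)%type.
Local Notation q := #|{: Y}|.
Local Notation mon := 'X_{1..q}.
Implicit Types m : mon.

Hypothesis H_gen : forall f, f \in H ->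
  f \in ideal_gen (fun f => `[< exists a, f = 'X_[u a] >]).
Hypothesis u_H : forall a, 'X_[u a] \in H.
Hypothesis u_deg : forall a, mdeg (u a) = delta.
Hypothesis u_min : forall e, min_monomial_gen H e <-> exists a, e = u a.

Definition gen_exp (x : Y) : 'X_{1..N} :=
  match x with inl v => U_(v)%MM | inr a => u a end.

Definition gen_tdeg (x : Y) : nat := if x is inr _ then 1%N else 0%N.

Lemma gen_subproof (x : Y) : 'X_[gen_exp x] *: 'X^(gen_tdeg x) \in rees_pred H.
Proof.
apply/asboolP => j; rewrite coefZ coefXn.
case: x => [v|a] /=; case: eqP => [->|_]; rewrite ?mulr1 ?mulr0; try exact: ideal_gen0.
  exact: ideal_pow0.
apply/ideal_gen_incl/asboolP; exists [tuple 'X_[u a]].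
by rewrite big_seq1; split=> // x; rewrite inE => /eqP->; apply: u_H.
Qed.

Definition rees_gen (i : 'I_q) : rees H := Rees (gen_subproof (enum_val i)).

Definition exp_of m : 'X_{1..N} := (\sum_(i < q) gen_exp (enum_val i) *+ m i)%MM.

Definition tdeg_of m : nat := (\sum_(i < q) gen_tdeg (enum_val i) * m i)%N.

Local Notation ev := (mmap1 rees_gen).

Lemma exp_ofD m m' : exp_of (m + m')%MM = (exp_of m + exp_of m')%MM.
Proof.
rewrite /exp_of -big_split /=; apply: eq_bigr => i _; apply/mnmP => j.
by rewrite !(mnmDE, mulmnE) mulnDr.
Qed.

Lemma tdeg_ofD m m' : tdeg_of (m + m')%MM = (tdeg_of m + tdeg_of m')%N.
Proof.
by rewrite /tdeg_of -big_split /=; apply: eq_bigr => i _; rewrite mnmDE mulnDr.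
Qed.

Lemma exp_ofU i : exp_of U_(i)%MM = gen_exp (enum_val i).
Proof.
rewrite /exp_of (bigD1 i) //= mnm1E eqxx mulm1n big1 ?addm0 // => j ji.
by rewrite mnm1E eq_sym (negbTE ji) mulm0n.
Qed.

Lemma tdeg_ofU i : tdeg_of U_(i)%MM = gen_tdeg (enum_val i).
Proof.
rewrite /tdeg_of (bigD1 i) //= mnm1E eqxx muln1 big1 ?addn0 // => j ji.
by rewrite mnm1E eq_sym (negbTE ji) muln0.
Qed.

Lemma exp_of0 : exp_of 0%MM = 0%MM.
Proof. by rewrite /exp_of big1 // => i _; rewrite mnm0E mulm0n. Qed.

Lemma tdeg_of0 : tdeg_of 0%MM = 0%N.
Proof. by rewrite /tdeg_of big1 // => i _; rewrite mnm0E muln0. Qed.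

Lemma mnm_ind (P : mon -> Prop) :
  P 0%MM -> (forall i m, P m -> P (U_(i) + m)%MM) -> forall m, P m.
Proof.
move=> P0 PS m; have [d] := ubnP (mdeg m); elim: d m => // d IH m md.
have [->//|m0] := eqVneq m 0%MM.
have [i mi] : exists i, (0 < m i)%N.
  apply/existsP; apply: contraNT m0 => /existsPn h; apply/eqP/mnmP => i.
  by have := h i; rewrite lt0n negbK mnm0E => /eqP.
rewrite (mnm_split1 mi); apply/PS/IH; move: md.
by rewrite {1}(mnm_split1 mi) mdegD mdeg1.
Qed.

Lemma rees_val_ev m : rees_val (ev m) = 'X_[exp_of m] *: 'X^(tdeg_of m).
Proof.
elim/mnm_ind: m => [|i m IH].
  by rewrite mmap11 exp_of0 tdeg_of0 mpolyX0 scale1r expr0.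
rewrite evD evU /= IH exp_ofD tdeg_ofD exp_ofU tdeg_ofU mpolyXD exprD.
by rewrite -scalerAl -scalerAr scalerA.
Qed.

Definition rees_coef m (f : rees H) : K := ((rees_val f)`_(tdeg_of m))@_(exp_of m).

Lemma rees_coef_scalar m : scalar (rees_coef m).
Proof.
move=> c f g; rewrite /rees_coef /= coefD coefZ mcoeffD.
by rewrite -scalerAl mul1r mcoeffZ.
Qed.

HB.instance Definition _ m :=
  GRing.isLinear.Build K (rees H) K *%R (rees_coef m) (rees_coef_scalar m).

Lemma rees_coef_ev m m' : rees_coef m (ev m') =
  ((exp_of m == exp_of m') && (tdeg_of m == tdeg_of m'))%:R.
Proof.
rewrite /rees_coef rees_val_ev coefZ coefXn.
case: (tdeg_of m =P _) => _; rewrite ?mulr1 ?mulr0 ?mcoeff0 ?andbF //.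
by rewrite mcoeffX andbT eq_sym.
Qed.

(** [f * t ^ j] is a combination of values of monomials in the generators; the
    degree in [t] is fixed so that an element of [H] raises it by one. *)
Definition ev_span (j : nat) (f : S) : Prop := exists s : seq (K * mon),
  f *: 'X^j = \sum_(z <- s) z.1%:A *: rees_val (ev z.2).

Lemma ev_spanD j f g : ev_span j f -> ev_span j g -> ev_span j (f + g).
Proof.
by move=> [s sE] [s' sE']; exists (s ++ s'); rewrite big_cat scalerDl sE sE'.
Qed.

Lemma ev_span0 j : ev_span j 0.
Proof. by exists [::]; rewrite big_nil scale0r. Qed.

Lemma ev_spanZ j c f : ev_span j f -> ev_span j (c *: f).
Proof.
move=> [s sE]; exists [seq (c * z.1, z.2) | z <- s].
rewrite big_map -mul_mpolyC -scalerA sE scaler_sumr; apply: eq_bigr => z _ /=.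
rewrite scalerA; congr (_ *: _); rewrite -scalerA.
by rewrite -[RHS]mul_mpolyC.
Qed.

Lemma ev_span_gen j (x : Y) f : ev_span j f ->
  ev_span (gen_tdeg x + j) ('X_[gen_exp x] * f).
Proof.
move=> [s sE]; exists [seq (z.1, (U_(enum_rank x) + z.2)%MM) | z <- s].
rewrite big_map exprD -scalerA scalerAr sE mulr_sumr scaler_sumr.
apply: eq_bigr => z _ /=; rewrite evD evU /= enum_rankK.
by rewrite -scalerAr scalerA mulrC -scalerA scalerAl.
Qed.

Lemma ev_spanM j p f : ev_span j f -> ev_span j (p * f).
Proof.
move=> fj; rewrite [p]mpolyE mulr_suml; elim/big_ind: _ => [||e _].
- exact: ev_span0.
- exact: ev_spanD.
rewrite -scalerAl; apply: ev_spanZ; rewrite mpolyXE_id.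
elim/big_ind: _ f fj => [f|g h Hg Hh f fj|v _ f fj]; rewrite ?mul1r //.
  by rewrite -mulrA; apply/Hg/Hh.
elim: (e v) => [|k IH]; first by rewrite mul1r.
by rewrite exprS -mulrA; apply: (ev_span_gen (inl v)).
Qed.

Lemma ev_span_H j h f : h \in H -> ev_span j f -> ev_span j.+1 (h * f).
Proof.
move=> /H_gen/asboolP[s [sG ->]] fj; rewrite mulr_suml big_seq.
elim/big_ind: _ => [||z zs].
- exact: ev_span0.
- exact: ev_spanD.
have /asboolP[a ->] := sG _ (map_f snd zs).
by rewrite -mulrA; apply/ev_spanM/(ev_span_gen (inr a)).
Qed.

Lemma ev_span_pow j f : f \in ideal_pow H j -> ev_span j f.
Proof.
move=> /asboolP[s [sG ->]]; rewrite big_seq; elim/big_ind: _ => [||z zs].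
- exact: ev_span0.
- exact: ev_spanD.
have /asboolP[t [tH ->]] := sG _ (map_f snd zs); apply: ev_spanM.
have : all (mem H) t by apply/allP.
rewrite -[X in ev_span X](size_tuple t); elim: (tval t) => [_|h t' IH /andP[hH tH']].
  exists [:: (1, 0%MM)]; rewrite big_seq1 big_nil /= rees_val_ev exp_of0 tdeg_of0.
  by rewrite mpolyX0 !scale1r.
by rewrite big_cons; apply: ev_span_H (IH _).
Qed.

Lemma rees_span (x : rees H) : exists s : seq (K * mon),
  x = \sum_(z <- s) z.1 *: ev z.2.
Proof.
have [s sE] : exists s : seq (K * mon),
    rees_val x = \sum_(z <- s) z.1%:A *: rees_val (ev z.2).
  rewrite -[rees_val x]coefK poly_def.
  elim/big_ind: _ => [|f g [s sE] [s' sE']|j _].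
  - by exists [::]; rewrite big_nil.
  - by exists (s ++ s'); rewrite big_cat sE sE'.
  by apply: ev_span_pow; have /asboolP := rees_valP x; apply.
exists s; apply: val_inj; rewrite /= sE.
by elim: s {sE} => [|z s IH]; rewrite ?big_nil // !big_cons IH.
Qed.

(** As all the [u a] have degree [delta], the bidegree in [S[t]] determines the
    degree in the generators. *)
Lemma mdeg_exp_of m : (mdeg (exp_of m) + tdeg_of m = mdeg m + tdeg_of m * delta)%N.
Proof.
elim/mnm_ind: m => [|i m IH]; first by rewrite exp_of0 tdeg_of0 !mdeg0.
rewrite exp_ofD tdeg_ofD !mdegD mdeg1 exp_ofU tdeg_ofU.
suff : (mdeg (gen_exp (enum_val i)) + gen_tdeg (enum_val i) =
        1 + gen_tdeg (enum_val i) * delta)%N by nia.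
by case: (enum_val i) => [v|a] /=; rewrite ?mdeg1 ?u_deg; lia.
Qed.

Lemma tdeg_of_le m : (tdeg_of m <= mdeg m)%N.
Proof.
elim/mnm_ind: m => [|i m IH]; first by rewrite tdeg_of0.
rewrite tdeg_ofD mdegD mdeg1 tdeg_ofU leq_add //.
by case: (enum_val i).
Qed.

Lemma ev_bigr m : ev m \in rees_bigr H (mdeg m - tdeg_of m) (tdeg_of m).
Proof.
suff [e [t [de tmin eE]]] : exists (e : 'X_{1..N}) (t : (tdeg_of m).-tuple 'X_{1..N}),
    [/\ (mdeg e + tdeg_of m = mdeg m)%N, forall k, min_monomial_gen H (tnth t k) &
    exp_of m = (e + \sum_(x <- t) x)%MM].
  apply/asboolP; exists [:: (1, ev m)]; rewrite big_seq1 scale1r; split=> // x.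
  rewrite inE => /eqP->; apply/asboolP; exists e, t; split=> //; first by rewrite -de addnK.
  rewrite rees_val_ev eE mpolyXD; congr ((_ * _) *: _).
  by rewrite -mpolyX_prod big_tuple.
elim/mnm_ind: m => [|i m [e [t [de tmin eE]]]].
  rewrite tdeg_of0 exp_of0 mdeg0; exists 0%MM, [tuple]; rewrite mdeg0 big_nil addm0.
  by split=> // -[].
rewrite tdeg_ofD tdeg_ofU mdegD mdeg1 exp_ofD exp_ofU eE.
case: (enum_val i) => [v|a] /=.
  by exists (U_(v) + e)%MM, t; rewrite mdegD mdeg1 addmA; split=> //; lia.
exists e, [tuple of u a :: t]; split; first by lia.
  move=> k; have := mem_tnth k [tuple of u a :: t].
  rewrite inE => /orP[/eqP->|/tnthP[k' ->] //]; apply/u_min.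
  by exists a.
by rewrite big_cons !addmA [(u a + e)%MM]addmC.
Qed.

Variables (bad : rel Y) (wt : Y -> nat).

Hypothesis bad_sym : ssrbool.symmetric bad.
Hypothesis bad_irr : irreflexive bad.
Hypothesis bad_rewrite : forall x x', bad x x' -> exists z z',
  [/\ (gen_exp x + gen_exp x' = gen_exp z + gen_exp z')%MM,
      (gen_tdeg x + gen_tdeg x' = gen_tdeg z + gen_tdeg z')%N &
      (wt z + wt z' < wt x + wt x')%N].

Local Notation badI := (fun i j : 'I_q => bad (enum_val i) (enum_val j)).

Hypothesis exp_inj : forall m m', standard badI m -> standard badI m' ->
  exp_of m = exp_of m' -> tdeg_of m = tdeg_of m' -> m = m'.

(** The coefficients in [S[t]] separate the standard monomials, by [exp_inj];
    they are the dual functionals that the general theorem asks for. *)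
Theorem monomial_rees_koszul : koszul (rees_gr H).
Proof.
have nnI_rewrite (i j : 'I_q) : badI i j -> exists i' j' : 'I_q,
    rees_gen i * rees_gen j = rees_gen i' * rees_gen j' /\
    (wt (enum_val i') + wt (enum_val j') < wt (enum_val i) + wt (enum_val j))%N.
  move=> /bad_rewrite[z [z' [e1 e2 e3]]]; exists (enum_rank z), (enum_rank z').
  rewrite !enum_rankK; split=> //; apply: val_inj.
  rewrite /= !enum_rankK -!scalerAl -!scalerAr !scalerA -!exprD -!mpolyXD.
  by rewrite e1 e2.
have coef_ev m m' : standard badI m -> standard badI m' ->
    rees_coef m (ev m') = (m == m')%:R.
  move=> sm sm'; rewrite rees_coef_ev; case: (m =P m') => [->|ne]; first by rewrite !eqxx.
  by case: eqP => //= e; case: eqP => // e'; case: ne; apply: exp_inj.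
apply: (pbw_koszul (y := rees_gen) (bad := badI) (wt := fun i => wt (enum_val i))
  (cof := fun m => rees_coef m : {scalar rees H})) => //.
- exact: rees_span.
move=> d x; split=> [/asboolP[g [gb ->]] m sm|xd].
  apply: contraNeq => md; rewrite linear_sum /= big1 // => b _.
  have /asboolP[s [sG ->]] := gb b; rewrite linear_sum /= big_seq big1 // => z zs.
  have /asboolP[e [t [de tmin vE]]] := sG _ (map_f snd zs).
  rewrite linearZ /=; apply/eqP; rewrite mulf_eq0; apply/orP; right; apply/eqP.
  rewrite /rees_coef vE coefZ coefXn; case: eqP => [bE|_]; last by rewrite mulr0 mcoeff0.
  rewrite mulr1 -(big_tuple _ _ t xpredT (fun x => 'X_[x])) mpolyX_prod -mpolyXD.
  rewrite mcoeffX; case: eqP => // eE.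
  case/eqP: md; have := mdeg_exp_of m; rewrite -eE mdegD mdeg_sum bE de.
  rewrite big_tuple (eq_bigr (fun _ => delta)); last first.
    by move=> k _; have /u_min[a ->] := tmin k.
  rewrite sum_nat_const card_ord; have := ltn_ord b; lia.
have [U [_ sU xE]] := @standard_expand _ _ _ rees_gen badI (fun i => wt (enum_val i))
  (fun m => rees_coef m : {scalar rees H}) (fun i => bad_irr (enum_val i))
  nnI_rewrite rees_span coef_ev x.
apply/asboolP; exists (fun b : 'I_d.+1 =>
  \sum_(m <- U | (rees_coef m x != 0) && (tdeg_of m == b)) rees_coef m x *: ev m); split.
  move=> b; rewrite big_seq_cond; apply/asboolP.
  elim/big_ind: _ => [|f f' [s [sG ->]] [s' [sG' ->]]|m /and3P[mU m0 /eqP mb]].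
  - by exists [::]; rewrite big_nil.
  - exists (s ++ s'); rewrite big_cat; split=> // z.
    by rewrite map_cat mem_cat => /orP[/sG|/sG'].
  have /asboolP[s [sG ->]] := ev_bigr m.
  exists [seq (rees_coef m x * z.1, z.2) | z <- s]; split.
    move=> z; rewrite -map_comp => /sG; rewrite -mb.
    by rewrite (xd m) // (allP sU).
  by rewrite big_map scaler_sumr; apply: eq_bigr => z _; rewrite scalerA.
rewrite [LHS]xE (exchange_big_dep (fun m => rees_coef m x != 0)) /=; last by move=> ? ? _ /andP[].
rewrite (bigID (fun m => rees_coef m x != 0)) /= [X in _ + X]big1 ?addr0; last first.
  by move=> m /negPn/eqP->; rewrite scale0r.
rewrite big_seq_cond [RHS]big_seq_cond; apply: eq_bigr => m /andP[mU m0].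
have lt : (tdeg_of m < d.+1)%N by rewrite ltnS -(xd m (allP sU _ mU) m0) tdeg_of_le.
by rewrite (eq_bigl (pred1 (Ordinal lt))) ?big_pred1_eq // => b; rewrite m0 eq_sym.
Qed.

End MonomialRees.

(** * Minimal primes and vertex covers *)

Section MinimalPrimes.

Local Open Scope ring_scope.

Variables (K : fieldType) (N : nat).
Local Notation S := {mpoly K[N]}.

(** Setting the variables of [F] to 0 is a morphism to a domain with kernel
    [var_ideal F]; this shows that [var_ideal F] is prime. *)
Definition kill_vars (F : {set 'I_N}) : S -> S :=
  mmap (@mpolyC N K) (fun i => if i \in F then 0 else 'X_i).

HB.instance Definition _ F := GRing.RMorphism.on (kill_vars F).

Lemma kill_varsX F i : kill_vars F 'X_i = if i \in F then 0 else 'X_i.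
Proof. by rewrite /kill_vars mmapX mmap1U. Qed.

Lemma ideal_gen_subset (R : comNzRingType) (G Q : {pred R}) :
  0 \in Q -> (forall a, {in Q &, forall u v, a * u + v \in Q}) ->
  {subset G <= Q} -> {subset ideal_gen G <= Q}.
Proof.
move=> Q0 QD GQ f /asboolP[s [sG ->]]; rewrite big_seq.
elim/big_rec: _ => // z v zs vQ; apply: QD => //; apply: GQ; apply: sG.
exact: map_f.
Qed.

Lemma kill_vars_congr F f : f - kill_vars F f \in @var_ideal K N F.
Proof.
rewrite [f]mpolyE; elim/big_ind: _ => [|f1 f2 h1 h2|m _].
- by rewrite rmorph0 subr0; apply: ideal_gen0.
- by rewrite rmorphD opprD addrACA; apply: ideal_genD.
rewrite -mul_mpolyC rmorphM /= /kill_vars mmapC -mulrBr; apply: ideal_genM.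
rewrite -/(kill_vars F) mpolyXE_id.
elim/big_ind: _ => [|f1 f2 h1 h2|i _].
- by rewrite rmorph1 subrr; apply: ideal_gen0.
- have -> : f1 * f2 - kill_vars F (f1 * f2) =
    f2 * (f1 - kill_vars F f1) + kill_vars F f1 * (f2 - kill_vars F f2).
    by rewrite rmorphM /=; move: (kill_vars F f1) (kill_vars F f2) => g1 g2; ring.
  by apply: ideal_genD; apply: ideal_genM.
elim: (m i) => [|k IH]; first by rewrite expr0 rmorph1 subrr; apply: ideal_gen0.
have -> : 'X_i ^+ k.+1 - kill_vars F ('X_i ^+ k.+1) =
  'X_i ^+ k * ('X_i - kill_vars F 'X_i)
  + kill_vars F 'X_i * ('X_i ^+ k - kill_vars F ('X_i ^+ k)).
  by rewrite !rmorphXn exprS /= exprS; move: (kill_vars F 'X_i) => g; ring.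
apply: ideal_genD; apply: ideal_genM => //; rewrite kill_varsX.
case: ifP => iF; last by rewrite subrr; apply: ideal_gen0.
by rewrite subr0; apply/ideal_gen_incl/asboolP; exists i.
Qed.

Lemma var_idealE F f : (f \in @var_ideal K N F) = (kill_vars F f == 0).
Proof.
apply/idP/eqP => [/asboolP[s [sG ->]]|f0]; last first.
  by have := kill_vars_congr F f; rewrite f0 subr0.
rewrite rmorph_sum big_seq big1 // => z zs.
have /asboolP[i iF zE] := sG _ (map_f snd zs).
by rewrite rmorphM /= zE kill_varsX iF mulr0.
Qed.

Lemma var_ideal_prime F : prime_ideal (@var_ideal K N F).
Proof.
split; first split.
- exact: ideal_gen0.
- by rewrite var_idealE rmorph1 oner_eq0.
- by move=> a f g fF gF; apply: ideal_genD => //; apply: ideal_genM.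
by move=> f g; rewrite !var_idealE rmorphM mulf_eq0.
Qed.

Lemma var_ideal_var F i : ('X_i \in @var_ideal K N F) = (i \in F).
Proof.
rewrite var_idealE kill_varsX; case: ifP => _; first by rewrite eqxx.
apply/eqP => /(congr1 (mcoeff U_(i))); rewrite mcoeffX eqxx mcoeff0.
by move/eqP; rewrite oner_eq0.
Qed.

Lemma prime_prod (Q : {pred S}) (s : seq 'I_N) : prime_ideal Q ->
  \prod_(i <- s) 'X_i \in Q -> exists2 i, i \in s & 'X_i \in Q.
Proof.
move=> [[_ Q1 _] Qp]; elim: s => [|i s IH]; first by rewrite big_nil (negbTE Q1).
rewrite big_cons => /Qp/orP[iQ|/IH[j js jQ]].
  by exists i; rewrite ?inE ?eqxx.
by exists j; rewrite ?inE ?js ?orbT.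
Qed.

Lemma prod_in_ideal (Q : {pred S}) (s : seq 'I_N) i : prime_ideal Q ->
  i \in s -> 'X_i \in Q -> \prod_(i <- s) 'X_i \in Q.
Proof.
move=> [[Q0 _ QD] _] si iQ; rewrite (big_rem i si) /= mulrC.
by rewrite -[_ * _]addr0; apply: QD.
Qed.

Variables (I : {pred S}) (edge : seq 'I_N -> Prop).

Hypothesis I_subP : forall Q : {pred S}, prime_ideal Q ->
  {subset I <= Q} <-> forall s, edge s -> \prod_(i <- s) 'X_i \in Q.

Definition vertex_cover (F : {set 'I_N}) : Prop :=
  forall s, edge s -> exists2 i, i \in s & i \in F.

Lemma var_ideal_cover F : {subset I <= @var_ideal K N F} <-> vertex_cover F.
Proof.
have pF := var_ideal_prime F; split=> [/(I_subP pF) h s es|h].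
  by have [i si] := prime_prod pF (h s es); rewrite var_ideal_var; exists i.
apply/(I_subP pF) => s es; have [i si iF] := h s es.
by apply: prod_in_ideal si _ => //; rewrite var_ideal_var.
Qed.

(** The variables in a prime containing the edge monomials form a cover, so
    below [var_ideal F] with [F] a minimal cover there is no smaller prime. *)
Lemma minimal_prime_cover F : minimal_prime I (@var_ideal K N F) <->
  vertex_cover F /\ forall F', vertex_cover F' -> F' \subset F -> F' = F.
Proof.
split=> [[_ IF minF]|[cF minF]].
  split; first exact/var_ideal_cover.
  move=> F' cF' F'F; apply/eqP; rewrite eqEsubset F'F; apply/subsetP => i iF.
  rewrite -var_ideal_var; apply: minF; rewrite ?var_ideal_var //.
  - exact: var_ideal_prime.
  - exact/var_ideal_cover.
  apply: ideal_gen_subset.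
  - exact: ideal_gen0.
  - by move=> a u v uF vF; apply: ideal_genD => //; apply: ideal_genM.
  by move=> f /asboolP[j jF' ->]; rewrite var_ideal_var (subsetP F'F).
split; first exact: var_ideal_prime; first exact/var_ideal_cover.
move=> Q pQ IQ QF; pose F' := [set i | 'X_i \in Q].
have F'F : F' = F.
  apply: minF => [s es|].
    have [i si iQ] := prime_prod pQ (proj1 (I_subP pQ) IQ s es).
    by exists i; rewrite ?inE.
  by apply/subsetP => i; rewrite inE => /QF; rewrite var_ideal_var.
case: pQ => -[Q0 _ QD] _; apply: ideal_gen_subset => // f /asboolP[i iF ->].
by move: iF; rewrite -F'F inE.
Qed.

End MinimalPrimes.

(** * Isotone sets: sorting, raising and uniqueness *)

Section IsotoneSubsets.

Variables (r n t : nat) (le : rel 'I_n).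
Hypothesis le_refl : reflexive le.
Hypothesis le_trans : transitive le.
Hypothesis le_anti : ssrbool.antisymmetric le.
Local Notation cell := ('I_r * 'I_n)%type.
Implicit Types (x v w : cell) (j k l : 'I_n).

Definition cum (a : {set cell}) (c : nat) (j : 'I_n) : nat :=
  \sum_(i < r | i < c) ((i, j) \in a).

Lemma cum0 a j : cum a 0 j = 0.
Proof. by rewrite /cum big_pred0. Qed.

Lemma cum_sat a c j : r <= c -> cum a c j = cum a r j.
Proof.
by move=> rc; apply: eq_bigl => i; rewrite ltn_ord (leq_trans (ltn_ord i) rc).
Qed.

Lemma cumS a (i : 'I_r) j : cum a i.+1 j = cum a i j + ((i, j) \in a).
Proof.
rewrite /cum (bigD1 i) //= addnC; congr (_ + _); apply: eq_bigl => i'.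
by rewrite ltnS [RHS]ltn_neqAle andbC -val_eqE.
Qed.

Lemma cum_mono a c c' j : c <= c' -> cum a c j <= cum a c' j.
Proof.
move=> cc'; rewrite /cum big_mkcond [X in _ <= X]big_mkcond /=.
apply: leq_sum => i _; case: (ltnP i c) => // ic.
by rewrite (leq_trans ic cc').
Qed.

Lemma nat_le_ind (Q : nat -> Prop) :
  Q 0 -> (forall i : 'I_r, Q i -> Q i.+1) -> forall c, c <= r -> Q c.
Proof.
move=> Q0 QS; elim=> // c IH cr.
by apply: (QS (Ordinal cr)); apply: IH; apply: ltnW.
Qed.

Lemma cum_le a c j : cum a c j <= c.
Proof.
have main : forall c, c <= r -> cum a c j <= c.
  apply: nat_le_ind => [|i h]; first by rewrite cum0.
  by rewrite cumS; case: (_ \in _); lia.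
have [/main//|/ltnW rc] := leqP c r.
by rewrite cum_sat //; apply: leq_trans rc; apply: main.
Qed.

Lemma eq_cum a b : (forall c j, c <= r -> cum a c j = cum b c j) -> a = b.
Proof.
move=> ab; apply/setP => -[i j]; have := ab i.+1 j (ltn_ord i).
rewrite !cumS ab; last by apply: ltnW.
by move/addnI; do 2![case: (_ \in _)].
Qed.

(** A function [g] with [g 0 j = 0] and steps 0 or 1 is the counting function of
    the set of its jumps. *)
Definition set_of_cum (g : nat -> 'I_n -> nat) : {set cell} :=
  [set x : cell | g x.1.+1 x.2 == (g x.1 x.2).+1].

Lemma cum_set_of_cum g : (forall j, g 0 j = 0) ->
  (forall (i : 'I_r) j, g i j <= g i.+1 j <= (g i j).+1) ->
  forall c j, c <= r -> cum (set_of_cum g) c j = g c j.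
Proof.
move=> g0 gS c j; move: c; apply: nat_le_ind; first by rewrite cum0 g0.
move=> i IH; rewrite cumS IH inE /=.
by have /andP[] := gS i j; case: eqP; lia.
Qed.

Definition isotone (a : {set cell}) : bool :=
  [forall j, cum a r j == t] &&
  [forall jk : 'I_n * 'I_n, le jk.1 jk.2 ==>
    [forall c : 'I_r.+1, cum a c jk.2 <= cum a c jk.1]].

Lemma isotoneP a : reflect ((forall j, cum a r j = t) /\
  (forall j k c, le j k -> cum a c k <= cum a c j)) (isotone a).
Proof.
apply: (iffP andP) => -[h1 h2]; split.
- by move=> j; apply/eqP; apply: (forallP h1).
- move=> j k c jk; move/forallP: h2 => /(_ (j, k)); rewrite jk /= => /forallP h2.
  have [cr|/ltnW rc] := leqP c r; first by have := h2 (inord c); rewrite inordK.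
  by rewrite !(cum_sat _ _ rc); have := h2 (inord r); rewrite inordK.
- by apply/forallP => j; rewrite h1.
by apply/forallP => -[j k]; apply/implyP => jk; apply/forallP => c; apply: h2.
Qed.

Definition lattice : finType := {a : {set cell} | isotone a}.
Implicit Types (a b : lattice).
Definition cells a : {set cell} := val a.
Local Notation cu a := (cum (cells a)).
Arguments cells : simpl never.

Lemma cu_top a j : cu a r j = t.
Proof. by have /isotoneP[h _] := valP a; apply: h. Qed.

Lemma cu_anti a c j k : le j k -> cu a c k <= cu a c j.
Proof. by have /isotoneP[_ h] := valP a; apply: h. Qed.

Lemma cu_le a c j : cu a c j <= t.
Proof.
have [cr|/ltnW rc] := leqP c r; first by rewrite -(cu_top a j) cum_mono.
by rewrite cum_sat // cu_top.
Qed.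

Definition near a b : bool :=
  [forall cj : 'I_r.+1 * 'I_n,
    cu a cj.1 cj.2 <= cu b cj.1 cj.2 <= (cu a cj.1 cj.2).+1].

Lemma nearP a b :
  reflect (forall c j, cu a c j <= cu b c j <= (cu a c j).+1) (near a b).
Proof.
apply: (iffP forallP) => h => [c j|[c j] //].
have [cr|/ltnW rc] := leqP c r; first by have := h (inord c, j); rewrite /= inordK.
by rewrite !(cum_sat _ _ rc); have := h (inord r, j); rewrite /= inordK.
Qed.

Definition sorted_pair a b : bool := near a b || near b a.

(** [x] is not in [a], some cell of [a] lies below [x] in its column, and moving
    the first such cell up to [x] preserves isotonicity: only the columns
    below that of [x] can object, and row [x.1.+1] decides since [cum] is
    constant up to the moved cell. *)
Definition raisable (x : cell) a : bool :=
  [&& x \notin cells a, cu a x.1 x.2 < t &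
    [forall k, le k x.2 && (k != x.2) ==> (cu a x.1.+1 x.2 < cu a x.1.+1 k)]].

Definition size_of a : nat := \sum_(cj : 'I_r.+1 * 'I_n) cu a cj.1 cj.2.

Definition depth a : nat := \sum_(cj : 'I_r.+1 * 'I_n) (t - cu a cj.1 cj.2).

(** The sum of the squares of the differences of two values of [cum], with [t]
    added to stay in the natural numbers.  Row 0, where [cum] vanishes, makes
    the single values count among the differences. *)
Definition spread a : nat :=
  \sum_(xy : ('I_r.+1 * 'I_n) * ('I_r.+1 * 'I_n))
    (cu a xy.1.1 xy.1.2 + (t - cu a xy.2.1 xy.2.2)) ^ 2.

(** The factor makes the depth dominate the spread. *)
Definition lat_weight a : nat :=
  ((\sum_b spread b).+1 * depth a + spread a).

Lemma raise_exists x a : raisable x a -> exists b w,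
  [/\ forall z, (z \in cells b) + (z == w) = (z \in cells a) + (z == x) &
      lat_weight b < lat_weight a].
Proof.
case: x => i j /and3P[/= xa ct /forallP hq].
have [i' [ii' i'a imin]] : exists i' : 'I_r, [/\ i < i', (i', j) \in cells a &
    forall i2 : 'I_r, i < i2 -> i2 < i' -> (i2, j) \notin cells a].
  have [i0 /andP[ii0 i0a]] : exists i0 : 'I_r, (i < i0) && ((i0, j) \in cells a).
    apply/existsP; apply: contraTT ct => /existsPn h; rewrite -leqNgt.
    rewrite -(cu_top a j); move: (ltn_ord i).
    suff main c : c <= r -> i < c -> cu a c j <= cu a i j by apply: main.
    move: c; apply: nat_le_ind => // i1 IH; rewrite ltnS leq_eqVlt => /orP[/eqP ii1|lt].
      by rewrite cumS -{2}(val_inj ii1) (negbTE xa) addn0 ii1.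
    by rewrite cumS; have := h i1; rewrite lt /= => /negbTE->; rewrite addn0 IH.
  have i0P : (i < i0) && ((i0, j) \in cells a) by rewrite ii0.
  have [i' /andP[? ?] h] := @arg_minnP _ i0
    (fun i' : 'I_r => (i < i') && ((i', j) \in cells a)) (fun i' => i' : nat) i0P.
  exists i'; split=> // i2 ii2 i2i'; apply/negP => i2a.
  by have := h i2; rewrite ii2 i2a => /(_ isT); lia.
(* Between the cell x and the moved cell (i', j) the count is constant. *)
have cc c : i < c -> c <= i' -> cu a c j = cu a i.+1 j.
  move=> ic ci'; have cr : c <= r by apply: leq_trans ci' (ltnW (ltn_ord i')).
  move: c cr ic ci'; apply: nat_le_ind => // i1 IH.
  rewrite ltnS leq_eqVlt => /orP[/eqP->//|ii1] i1i'.
  by rewrite cumS (negbTE (imin _ ii1 i1i')) addn0 IH // ltnW.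
pose b0 : {set cell} := (i, j) |: (cells a :\ (i', j)).
have b0E z : (z \in b0) + (z == (i', j)) = (z \in cells a) + (z == (i, j)).
  rewrite !inE; have [->|zi] := eqVneq z (i, j).
    by rewrite (negbTE xa) orTb; case: eqP => // -[e]; move: ii'; rewrite e ltnn.
  by case: eqP => [->|_]; rewrite ?i'a ?addn0.
have cumb0 c k : cum b0 c k + ((k == j) && (i' < c)) = cu a c k + ((k == j) && (i < c)).
  have cnt (i1 : 'I_r) : ((k == j) && (i1 < c) : nat) =
      \sum_(i2 < r | i2 < c) ((i2, k) == (i1, j)).
    have [/eqP->|nc] := boolP (k == j); last first.
      by rewrite big1 // => i2 _; rewrite xpair_eqE (negbTE nc) andbF.
    rewrite big_mkcond (bigD1 i1) //= eqxx big1 ?addn0; first by case: ifP.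
    by move=> i2 ne; rewrite xpair_eqE (negbTE ne); case: ifP.
  rewrite !cnt /cum -!big_split /=; apply: eq_bigr => i2 _; exact: b0E.
have ge c k : cu a c k <= cum b0 c k.
  by have := cumb0 c k; case: (k == j) => /=; [|lia]; case: ltnP; case: ltnP; lia.
have bP : isotone b0.
  apply/isotoneP; split=> [k|k l c kl].
    by have := cumb0 r k; rewrite !ltn_ord cu_top => /addIn.
  have [lj|lj] := eqVneq l j; last first.
    have := cumb0 c l; rewrite (negbTE lj) /= !addn0 => ->.
    by apply: leq_trans (ge c k); apply: cu_anti.
  subst l; have [->//|kj] := eqVneq k j.
  have := cumb0 c k; rewrite (negbTE kj) /= !addn0 => ->.
  have := cumb0 c j; rewrite eqxx /=; have ca := cu_anti a c kl.
  have := hq k; rewrite kl kj /= => lt.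
  have := cum_mono (cells a) k (c := i.+1) (c' := c); have := cc c.
  case: (ltnP i c) => ic; case: (ltnP i' c) => ci' c1 c2 c3; lia.
pose b : lattice := exist isotone b0 bP.
exists b, (i', j); split=> //.
have : depth b < depth a.
  rewrite /depth [X in _ < X](bigD1 (inord i.+1, j)) //=.
  rewrite [X in X < _](bigD1 (inord i.+1, j)) //= -addSn.
  apply: leq_add; last by apply: leq_sum => -[c k] _ /=; apply: leq_sub2l; apply: ge.
  have := cumb0 i.+1 j; rewrite inordK ?ltnS // eqxx /=.
  have -> : cells b = b0 by [].
  have : cu a i.+1 j < t by rewrite cumS (negbTE xa) addn0.
  lia.
have : spread b <= \sum_b spread b by rewrite (bigD1 b) //= leq_addr.
rewrite /lat_weight; nia.
Qed.

Lemma sum_sq_balanced (g h g' h' : nat) : g + h = g' + h' ->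
  (g' <= h' <= g'.+1) || (h' <= g' <= h'.+1) ->
  g' ^ 2 + h' ^ 2 <= g ^ 2 + h ^ 2 /\
  ((g.+1 < h) || (h.+1 < g) -> g' ^ 2 + h' ^ 2 < g ^ 2 + h ^ 2).
Proof.
wlog gh : g h / g <= h.
  move=> main e bal; have [gh|/ltnW hg] := leqP g h; first exact: main.
  by rewrite orbC [g ^ 2 + _]addnC; apply: main; lia.
wlog gh' : g' h' / g' <= h'.
  move=> main e bal; have [gh'|/ltnW hg'] := leqP g' h'; first exact: main.
  by rewrite [g' ^ 2 + _]addnC; apply: main; lia.
move=> e bal.
have [f [fh | fh]] : exists f, h = g + f.*2 \/ h = g + f.*2.+1.
  by exists (h - g)./2; lia.
  have -> : h' = g + f by lia.
  have -> : g' = g + f by lia.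
  by rewrite fh -!mul2n !expnS !expn0 !muln1; split=> *; nia.
have -> : h' = (g + f).+1 by lia.
have -> : g' = g + f by lia.
by rewrite fh -!mul2n !expnS !expn0 !muln1; split=> *; nia.
Qed.

(** Halving [cum a + cum b] with both roundings gives counting functions of
    isotone sets, since their steps are again 0 or 1.  The pair is unsorted
    only if two of the values or of the differences of values are at least 2
    apart, and then balancing them lowers the spread. *)
Lemma sort_exists a b : ~~ sorted_pair a b -> exists a' b',
  (forall z, (z \in cells a) + (z \in cells b) = (z \in cells a') + (z \in cells b')) /\
  lat_weight a' + lat_weight b' < lat_weight a + lat_weight b.
Proof.
rewrite negb_or => /andP[nab nba].
pose sm c j := cu a c j + cu b c j.
pose glo c j := (sm c j)./2; pose ghi c j := uphalf (sm c j).
have smS (i : 'I_r) j : sm i j <= sm i.+1 j <= (sm i j).+2.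
  by rewrite /sm !cumS; do 2![case: (_ \in _)]; lia.
have sm0 j : sm 0 j = 0 by rewrite /sm !cum0.
have loE c j : c <= r -> cum (set_of_cum glo) c j = glo c j.
  apply: cum_set_of_cum => [k|i k]; rewrite /glo ?sm0 //.
  by have := smS i k; lia.
have hiE c j : c <= r -> cum (set_of_cum ghi) c j = ghi c j.
  apply: cum_set_of_cum => [k|i k]; rewrite /ghi ?sm0 //.
  by have := smS i k; lia.
have smt j : sm r j = t + t by rewrite /sm !cu_top.
have sm_anti c j k : le j k -> sm c k <= sm c j.
  by move=> jk; apply: leq_add; apply: cu_anti.
have loP : isotone (set_of_cum glo).
  apply/isotoneP; split=> [j|j k c jk]; first by rewrite loE // /glo smt; lia.
  suff main c' : c' <= r -> cum (set_of_cum glo) c' k <= cum (set_of_cum glo) c' j.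
    by have [/main//|/ltnW rc] := leqP c r; rewrite !(cum_sat _ _ rc) main.
  by move=> cr; rewrite !loE // /glo; apply/half_leq/sm_anti.
have hiP : isotone (set_of_cum ghi).
  apply/isotoneP; split=> [j|j k c jk]; first by rewrite hiE // /ghi smt; lia.
  suff main c' : c' <= r -> cum (set_of_cum ghi) c' k <= cum (set_of_cum ghi) c' j.
    by have [/main//|/ltnW rc] := leqP c r; rewrite !(cum_sat _ _ rc) main.
  by move=> cr; rewrite !hiE // /ghi; apply/uphalf_leq/sm_anti.
pose a' : lattice := exist isotone _ loP; pose b' : lattice := exist isotone _ hiP.
have a'E (c : 'I_r.+1) j : cu a' c j = glo c j by apply: loE; rewrite -ltnS.
have b'E (c : 'I_r.+1) j : cu b' c j = ghi c j by apply: hiE; rewrite -ltnS.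
have sumE (c : 'I_r.+1) j : cu a' c j + cu b' c j = cu a c j + cu b c j.
  by rewrite a'E b'E /glo /ghi -/(sm c j); lia.
have near' (c : 'I_r.+1) j : cu a' c j <= cu b' c j <= (cu a' c j).+1.
  by rewrite a'E b'E /glo /ghi; lia.
have ltr (c : 'I_r.+1) : c <= r by rewrite -ltnS.
exists a', b'; split.
  move=> [i j]; have := sumE (inord i.+1) j; have := sumE (inord i) j.
  rewrite !inordK ?ltnS //; last by apply: ltnW.
  by rewrite !cumS /=; lia.
have dE : depth a' + depth b' = depth a + depth b.
  rewrite /depth -!big_split /=; apply: eq_bigr => -[c j] _ /=.
  have := sumE c j; have := cu_le a c j; have := cu_le b c j.
  have := cu_le a' c j; have := cu_le b' c j; lia.
suff : spread a' + spread b' < spread a + spread b by rewrite /lat_weight; nia.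
pose term e (xy : ('I_r.+1 * 'I_n) * ('I_r.+1 * 'I_n)) :=
  cu e xy.1.1 xy.1.2 + (t - cu e xy.2.1 xy.2.2).
have bal xy : (term a xy) + (term b xy) = (term a' xy) + (term b' xy) /\
    ((term a' xy <= term b' xy <= (term a' xy).+1) ||
     (term b' xy <= term a' xy <= (term b' xy).+1)).
  rewrite /term; case: xy => -[c j] [c' j'] /=.
  have := sumE c j; have := sumE c' j'; have := near' c j; have := near' c' j'.
  have := cu_le a c' j'; have := cu_le b c' j'.
  have := cu_le a' c' j'; have := cu_le b' c' j'; lia.
have [xy far] : exists xy, ((term a xy).+1 < term b xy) || ((term b xy).+1 < term a xy).
  move: nab nba; rewrite /near !negb_forall => /existsP[[c j] /= h1] /existsP[[c' j'] /= h2].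
  (* Two values at distance at least 2 are compared with row 0; otherwise one
     value goes up by 1, another one down, and their difference moves by 2. *)
  have [far|nfar] := boolP (((cu a c j).+1 < cu b c j) || ((cu b c j).+1 < cu a c j)).
    by exists ((c, j), (ord0, j)); rewrite /term /= !cum0; lia.
  have [far|nfar'] := boolP (((cu a c' j').+1 < cu b c' j') || ((cu b c' j').+1 < cu a c' j')).
    by exists ((c', j'), (ord0, j')); rewrite /term /= !cum0; lia.
  exists ((c, j), (c', j')); rewrite /term /=.
  have := cu_le a c' j'; have := cu_le b c' j'; lia.
rewrite /spread -!big_split /= (bigD1 xy) // [X in _ < X](bigD1 xy) //= -addSn.
apply: leq_add.
  by have [e1 e2] := bal xy; have [_] := sum_sq_balanced e1 e2; apply.
by apply: leq_sum => z _; have [e1 e2] := bal z; have [] := sum_sq_balanced e1 e2.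
Qed.

Lemma near_le a b c j : near a b -> cu a c j <= cu b c j.
Proof. by move/nearP/(_ c j)/andP=> []. Qed.

Lemma near_size a b c j : near a b -> size_of b <= size_of a -> cu a c j = cu b c j.
Proof.
move=> ab ba.
have eq1 (cj : 'I_r.+1 * 'I_n) : cu a cj.1 cj.2 = cu b cj.1 cj.2.
  apply/eqP; rewrite eqn_leq near_le //= leqNgt; apply/negP => lt.
  move: ba; rewrite leqNgt => /negP; apply.
  rewrite /size_of (bigD1 cj) // [X in _ < X](bigD1 cj) //= -addSn.
  by apply: leq_add => //; apply: leq_sum => cj' _; apply: near_le.
have [cr|/ltnW rc] := leqP c r; first by have := eq1 (inord c, j); rewrite /= inordK.
by rewrite !(cum_sat _ _ rc); have := eq1 (inord r, j); rewrite /= inordK.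
Qed.

(** A multiset of isotone sets is its multiplicity function [S]. *)
Definition csum (S : lattice -> nat) (c : nat) j := \sum_a S a * cu a c j.

Definition content (S : lattice -> nat) (x : cell) := \sum_a S a * (x \in cells a).

Definition all_sorted (S : lattice -> nat) : Prop :=
  forall a b, 0 < S a -> 0 < S b -> sorted_pair a b.

Lemma csumS S (i : 'I_r) j : csum S i.+1 j = csum S i j + content S (i, j).
Proof.
by rewrite /csum /content -big_split /=; apply: eq_bigr => a _; rewrite cumS mulnDr.
Qed.

Lemma csum_anti S c j k : le j k -> csum S c k <= csum S c j.
Proof. by move=> jk; apply: leq_sum => a _; rewrite leq_mul2l cu_anti ?orbT. Qed.

Lemma csum0 S j : csum S 0 j = 0.
Proof. by rewrite /csum big1 // => a _; rewrite cum0 muln0. Qed.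

(** Compare the counts [h] down to the row of [x] in its column.  Among the
    factors with the least count the greatest one, [a], works: the factors
    below [a] have the same count, those above [a] have one more.  If [a] could
    not be raised, every factor would show the same obstruction, and the sums
    would contradict the hypotheses. *)
Lemma raisable_exists S x : all_sorted S ->
  content S x < \sum_a S a -> csum S x.1.+1 x.2 < t * \sum_a S a ->
  (forall k, le k x.2 -> k != x.2 -> csum S x.1.+1 x.2 < csum S x.1.+1 k) ->
  exists2 a, 0 < S a & raisable x a.
Proof.
case: x => i j /= srt ct lt_t lt_k.
have [a1 a1S] : exists a1, 0 < S a1.
  apply/existsP; apply: contraTT ct => /existsPn h.
  by rewrite -leqNgt big1 // => a _; have := h a; rewrite lt0n negbK => /eqP.
pose h a := cu a i.+1 j.
have [a0 a0S a0min] := @arg_minnP _ a1 (fun a => 0 < S a) h a1S.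
have a0P : (0 < S a0) && (h a0 == h a0) by rewrite a0S eqxx.
have [a /andP[aS /eqP ah] amax] :=
  @arg_maxnP _ a0 (fun a => (0 < S a) && (h a == h a0)) size_of a0P.
have same b : 0 < S b -> h b = h a -> forall c k, cu b c k <= cu a c k <= (cu b c k).+1.
  move=> bS bh; apply/nearP; have /orP[//|ab] := srt b a bS aS.
  have sz : size_of b <= size_of a by apply: amax; rewrite bS bh ah eqxx.
  by apply/nearP => c k; rewrite (near_size c k ab sz) leqnn leqnSn.
have above b : 0 < S b -> h b != h a -> h a < h b /\
    forall c k, cu a c k <= cu b c k <= (cu a c k).+1.
  move=> bS bh; have lt : h a < h b by have := a0min b bS; lia.
  split=> //; apply/nearP; have /orP[ba|//] := srt b a bS aS.
  by have := near_le i.+1 j ba; rewrite -/(h a) -/(h b); lia.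
exists a => //; apply/and3P; split=> /=.
- apply: contraTN ct => ija; rewrite -leqNgt; apply: leq_sum => b _.
  have [->|bS] := posnP (S b); first by [].
  suff -> : (i, j) \in cells b by rewrite muln1.
  have := cumS (cells a) i j; rewrite ija; have := cumS (cells b) i j.
  have [bh|/(above b bS)[]] := eqVneq (h b) (h a).
    have := same b bS bh i j; rewrite /h in bh.
    by case: (_ \in cells b); lia.
  by rewrite {1 2}/h => lt /(_ i j); case: (_ \in cells b); lia.
- rewrite ltnNge; apply/negP => ge; move: lt_t; rewrite ltnNge => /negP; apply.
  rewrite mulnC big_distrl; apply: leq_sum => b _ /=.
  have [->|bS] := posnP (S b); first by [].
  rewrite leq_mul2l; apply/orP; right; apply: leq_trans ge _.
  apply: leq_trans (cum_mono _ _ (leqnSn i)) _.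
  have [bh|/(above b bS)[lt _]] := eqVneq (h b) (h a).
    by rewrite -/(h a) -/(h b) bh.
  exact: ltnW.
apply/forallP => k; apply/implyP => /andP[kj kne]; rewrite ltnNge; apply/negP => ge.
have := lt_k k kj kne; rewrite ltnNge => /negP; apply.
apply: leq_sum => b _; have [->|bS] := posnP (S b); first by [].
rewrite leq_mul2l; apply/orP; right.
have [bh|/(above b bS)[lt /(_ i.+1 k)]] := eqVneq (h b) (h a).
  by have := same b bS bh i.+1 k; rewrite /h in bh; lia.
by rewrite /h in lt; lia.
Qed.

Lemma csum_le_top S c j : c <= r -> csum S c j <= t * \sum_a S a.
Proof.
move=> cr; rewrite mulnC big_distrl; apply: leq_sum => a _ /=.
by rewrite leq_mul2l cu_le orbT.
Qed.

(** Otherwise consider a minimal column and then the first row where [S'] gets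
    ahead.  There [S] uses the cell less often than [S'], so the cell occurs
    in the residue [xi]; and the smaller columns leave room to raise some
    factor of [S] to it. *)
Lemma csum_maximal S S' (xi xi' : cell -> nat) :
  all_sorted S -> (forall x a, 0 < xi x -> 0 < S a -> ~~ raisable x a) ->
  \sum_a S a = \sum_a S' a ->
  (forall x, content S x + xi x = content S' x + xi' x) ->
  forall c j, c <= r -> csum S' c j <= csum S c j.
Proof.
move=> srt nr tot same; set J := \sum_a S a.
pose bad j := [exists c : 'I_r.+1, csum S c j < csum S' c j].
suff nbad j : ~~ bad j.
  move=> c j cr; have /existsPn/(_ (inord c)) := nbad j.
  by rewrite inordK // -leqNgt.
have [d] := ubnP #|[set k | le k j]|; elim: d j => // d IH j jd.
apply/negP => /existsP[c0 c0P].
have ex : exists c, (c <= r) && (csum S c j < csum S' c j).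
  by exists c0; rewrite c0P -ltnS ltn_ord.
have [[|c] /andP[cr cP] cmin] := ex_minnP ex; first by rewrite !csum0 in cP.
pose i := Ordinal cr.
have ci : csum S' i j <= csum S i j.
  by rewrite leqNgt; apply/negP => lt; have := cmin i; rewrite lt ltnW //= ltnn => /(_ isT).
have := cP; rewrite -[c.+1]/(i.+1) => lt.
have cont : content S (i, j) < content S' (i, j).
  by move: lt; rewrite !csumS; lia.
have cont' : content S' (i, j) <= J.
  rewrite /J tot; apply: leq_sum => a _.
  by case: (_ \in _); rewrite ?muln1 ?muln0.
have [a aS ra] : exists2 a, 0 < S a & raisable (i, j) a.
  apply: raisable_exists => //=; first by apply: leq_trans cont'.
    by apply: leq_trans lt _; rewrite -/J /J tot csum_le_top.
  move=> k kj kne; have nk : ~~ bad k.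
    apply: IH; apply: leq_trans (jd : _ <= d); apply: proper_card.
    apply/properP; split; first by apply/subsetP => l; rewrite !inE => lk; apply: le_trans kj.
    exists j; rewrite inE ?le_refl //; apply: contra kne => jk.
    by apply/eqP/le_anti; rewrite kj.
  have /existsPn/(_ (inord i.+1)) := nk; rewrite inordK // -leqNgt => le1.
  by apply: leq_trans lt _; apply: leq_trans (csum_anti _ _ kj) le1.
have xi_gt0 : 0 < xi (i, j) by have := same (i, j); lia.
by have := nr _ _ xi_gt0 aS; rewrite ra.
Qed.

(** Pairwise sorted sets form a chain with values of [cum] at most 1 apart, so
    the least of them is the mean rounded down; remove it and repeat. *)
Lemma all_sorted_unique S S' : all_sorted S -> all_sorted S' ->
  \sum_a S a = \sum_a S' a -> (forall c j, c <= r -> csum S c j = csum S' c j) ->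
  S =1 S'.
Proof.
have [J] := ubnP (\sum_a S a); elim: J S S' => // J IH S S' SJ srt srt' tot eqc.
have [S0|Spos] := posnP (\sum_a S a).
  move=> a; move: S0 (S0); rewrite {2}tot => /eqP; rewrite sum_nat_eq0 => /forallP/(_ a)/eqP->.
  by move=> /eqP; rewrite sum_nat_eq0 => /forallP/(_ a)/eqP->.
have least (T : lattice -> nat) : all_sorted T -> 0 < \sum_a T a ->
    exists2 a0, 0 < T a0 & forall c j, c <= r -> cu a0 c j = csum T c j %/ \sum_a T a.
  move=> srtT Tpos; have [a1 a1T] : exists a1, 0 < T a1.
    apply/existsP; apply: contraTT Tpos => /existsPn h.
    by rewrite -leqNgt big1 // => a _; have := h a; rewrite lt0n negbK => /eqP.
  have [a0 a0T a0min] := @arg_minnP _ a1 (fun a => 0 < T a) size_of a1T.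
  exists a0 => // c j cr.
  have nr b : 0 < T b -> cu a0 c j <= cu b c j <= (cu a0 c j).+1.
    move=> bT; have /orP[/nearP//|nb] := srtT a0 b a0T bT.
    by rewrite (near_size c j nb (a0min b bT)) leqnn leqnSn.
  have lo : (\sum_a T a) * cu a0 c j <= csum T c j.
    rewrite big_distrl; apply: leq_sum => b _ /=; rewrite leq_mul2l.
    by case: (posnP (T b)) => //= bT; case/andP: (nr b bT).
  have hi : csum T c j < (\sum_a T a) * (cu a0 c j).+1.
    rewrite big_distrl /csum (bigD1 a0) // [X in _ < X](bigD1 a0) //= -addSn.
    apply: leq_add; first by rewrite mulnS; lia.
    apply: leq_sum => b _; rewrite leq_mul2l.
    by case: (posnP (T b)) => //= bT; case/andP: (nr b bT).
  apply/eqP; rewrite eq_sym eqn_leq leq_divRL // [cu a0 c j * _]mulnC lo andbT.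
  by rewrite -ltnS ltn_divLR // mulnC.
have [a0 a0S a0E] := least S srt Spos.
have [a0' a0S' a0E'] := least S' srt' (leq_trans Spos (eq_leq tot)).
have e : a0' = a0.
  by apply: val_inj; apply: eq_cum => c j cr; rewrite a0E // a0E' // eqc // tot.
subst a0'.
have rm (T : lattice -> nat) : 0 < T a0 -> \sum_a T a = (\sum_a (T a - (a == a0))).+1.
  move=> T0; rewrite (bigD1 a0) //= [in RHS](bigD1 a0) //= eqxx -addSn; congr (_ + _); first by lia.
  by apply: eq_bigr => b /negbTE->; rewrite subn0.
have rmc (T : lattice -> nat) c j : 0 < T a0 ->
    csum T c j = csum (fun a => T a - (a == a0)) c j + cu a0 c j.
  move=> T0; rewrite /csum (bigD1 a0) //= [in RHS](bigD1 a0) //= eqxx addnAC.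
  congr (_ + _); first by rewrite mulnBl mul1n subnK // leq_pmull.
  by apply: eq_bigr => b /negbTE->; rewrite subn0.
have rms (T : lattice -> nat) : all_sorted T -> all_sorted (fun a => T a - (a == a0)).
  by move=> srtT a b Ta Tb; apply: srtT; lia.
have main : (fun a => S a - (a == a0)) =1 (fun a => S' a - (a == a0)).
  apply: IH; [|exact: rms|exact: rms| |].
  - by move: SJ; rewrite rm.
  - by move: tot; rewrite rm // [in RHS]rm // => -[].
  by move=> c j cr; have := eqc c j cr; rewrite rmc // [in RHS]rmc // => /addIn.
move=> a; have := main a; case: eqP => [->|_]; last by rewrite !subn0.
by lia.
Qed.

End IsotoneSubsets.

(** * Sets of cells meeting all chains *)

Section Covers.

Variables (r n s : nat) (le : rel 'I_n).
Hypothesis le_refl : reflexive le.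
Hypothesis le_trans : transitive le.
Hypothesis s_ge1 : 1 <= s.
Hypothesis s_le_r : s <= r.
Local Notation cell := ('I_r * 'I_n)%type.
Local Notation t := (r - s).+1.
Implicit Types (a b : {set cell}) (j k l : 'I_n).

Definition meets_chains (a : {set cell}) : Prop :=
  forall (c : 'I_r -> 'I_n) (A : {set 'I_r}),
    (forall i i' : 'I_r, i <= i' -> le (c i) (c i')) -> #|A| = s ->
    exists2 i, i \in A & (i, c i) \in a.

(** Along a chain avoiding [a], the number of cells above that are not in [a]
    increases strictly: it does so inside a column, and passing to a larger
    column at the same height can only increase it.  Since a column has [s - 1]
    cells outside [a], this leaves room for [s - 1] chain members. *)
Lemma isotone_meets_chains a : isotone t le a -> meets_chains a.
Proof.
move=> /isotoneP[top anti] c A mc As; apply/exists_inP; apply: contraT.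
rewrite negb_exists => /forallP out.
pose h (i : 'I_r) := i - cum a i (c i).
have notin i : i \in A -> (i, c i) \notin a.
  by move=> iA; have := out i; rewrite iA.
have step i : i \in A ->
    forall m, m <= r -> i < m -> cum a m (c i) + i.+1 <= cum a i (c i) + m.
  move=> iA; apply: nat_le_ind => // i1 IH.
  rewrite ltnS leq_eqVlt => /orP[/eqP ii1|/IH]; last first.
    by rewrite cumS; case: (_ \in _); lia.
  by rewrite cumS -(val_inj ii1) (negbTE (notin i iA)); lia.
have h_lt i i' : i \in A -> i' \in A -> i < i' -> h i < h i'.
  move=> iA i'A ii'.
  have := anti _ _ i' (mc i i' (ltnW ii')).
  have := step i iA i' (ltnW (ltn_ord i')) ii'.
  have := cum_le a i (c i); have := cum_le a i' (c i'); rewrite /h; lia.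
have h_s i : i \in A -> h i < s.-1.
  move=> iA.
  have := step i iA r (leqnn r) (ltn_ord i); rewrite top.
  have := cum_le a i (c i); rewrite /h; lia.
pose hs (i : 'I_r) : 'I_s := insubd (Ordinal s_ge1) (h i).
have hsE i : i \in A -> hs i = h i :> nat.
  by move=> iA; rewrite val_insubd (leq_trans (h_s i iA)) // leq_pred.
have inj : {in A &, injective hs}.
  move=> i i' iA i'A /(congr1 val) /=; rewrite !hsE // => e; apply/val_inj => /=.
  by case: (ltngtP i i') => // [/h_lt - /(_ iA i'A)|/h_lt - /(_ i'A iA)]; rewrite e ltnn.
have sub : hs @: A \subset [set k : 'I_s | k < s.-1].
  by apply/subsetP => k /imsetP[i iA ->]; rewrite inE hsE ?h_s.
have := subset_leq_card sub; rewrite card_in_imset // As.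
suff : #|[set k : 'I_s | k < s.-1]| < s by lia.
rewrite -[X in _ < X]card_ord; apply: proper_card; apply/properP; split.
  exact/subsetP.
have ls : s.-1 < s by lia.
by exists (Ordinal ls); rewrite // inE ltnn.
Qed.

(** The greatest length of a chain outside [a] within the first [c] rows and
    the columns up to [j]. *)
Fixpoint height (a : {set cell}) (c : nat) (j : 'I_n) : nat :=
  if c is c'.+1 then
    \max_(k | le k j) (height a c' k + [exists i : 'I_r, (i == c' :> nat) && ((i, k) \notin a)])
  else 0.

Lemma heightS a (i : 'I_r) j :
  height a i.+1 j = \max_(k | le k j) (height a i k + ((i, k) \notin a)).
Proof.
rewrite /=; apply: eq_bigr => k _; congr (_ + _); congr nat_of_bool.
apply/existsP/idP => [[i' /andP[/eqP e]]|ka]; last by exists i; rewrite eqxx.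
by rewrite (val_inj e).
Qed.

Lemma height_mono a c j k : le j k -> height a c j <= height a c k.
Proof.
case: c => // c jk /=; apply/bigmax_leqP => l lj.
exact: leq_trans (leq_bigmax_cond _ (le_trans lj jk)).
Qed.

Lemma height_step a (i : 'I_r) j :
  height a i j + ((i, j) \notin a) <= height a i.+1 j <= (height a i j).+1.
Proof.
rewrite heightS; apply/andP; split.
  exact: (leq_bigmax_cond (F := fun k => height a i k + ((i, k) \notin a))).
apply/bigmax_leqP => k kj; rewrite -addn1; apply: leq_add; first exact: height_mono.
by case: (_ \notin _).
Qed.

Lemma height_chain a c j : c <= r -> exists (f : 'I_r -> 'I_n) (A : {set 'I_r}),
  [/\ forall i i' : 'I_r, i <= i' -> le (f i) (f i'), forall i, le (f i) j,
      forall i, i \in A -> i < c, forall i, i \in A -> (i, f i) \notin a &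
      #|A| = height a c j].
Proof.
move=> cr; move: c cr j; apply: nat_le_ind => [j|i IH j].
  by exists (fun _ => j), set0; rewrite cards0; split=> // i; rewrite inE.
have [k kj kE] : exists2 k, le k j &
    height a i.+1 j = height a i k + ((i, k) \notin a).
  have ne : 0 < #|[pred k | le k j]| by apply/card_gt0P; exists j; rewrite inE le_refl.
  have [k kj kE] := eq_bigmax_cond (fun k => height a i k + ((i, k) \notin a)) ne.
  by exists k => //; rewrite heightS -kE; apply: eq_bigl.
have [f [A [f_mono fk Ai Aa Acard]]] := IH k.
exists (fun i' : 'I_r => if i' < i then f i' else k).
exists (if (i, k) \in a then A else i |: A); split.
- move=> i1 i2 i12; case: (ltnP i1 i) => i1i; case: (ltnP i2 i) => i2i //.
  + exact: f_mono.
  + by have := leq_ltn_trans i12 i2i; rewrite ltnNge i1i.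
- by move=> i'; case: ifP => _ //; apply: le_trans kj.
- move=> i'; case: ifP => _; first by move/Ai/ltnW.
  by rewrite !inE => /orP[/eqP->|/Ai/ltnW].
- move=> i'; case: ifP => ika; first by move=> i'A; rewrite Ai // Aa.
  rewrite !inE => /orP[/eqP->|i'A]; first by rewrite ltnn ika.
  by rewrite Ai // Aa.
rewrite kE; case: ifP => ika; first by rewrite Acard addn0.
by rewrite cardsU1 Acard addnC; case: (boolP (i \in A)) => // /Ai; rewrite ltnn.
Qed.

(** The jumps of the heights in a column contain all the cells outside [a] and
    are at most [s - 1] in number.  Taking the maximum with [c - t] adds jumps
    at the bottom of the column to make them exactly [s - 1]; the cells that
    are not jumps form the isotone set. *)
Lemma meets_chains_isotone a : meets_chains a -> exists2 b, isotone t le b & b \subset a.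
Proof.
move=> cov.
have height_lt j : height a r j < s.
  rewrite ltnNge; apply/negP => hs.
  have [f [A [f_mono _ _ Aa Acard]]] := height_chain a j (leqnn r).
  have [B BA Bs] : exists2 B : {set 'I_r}, B \subset A & #|B| = s.
    move: hs; rewrite -Acard => hs.
    exists [set x in take s (enum A)].
      by apply/subsetP => x; rewrite inE => /mem_take; rewrite mem_enum.
    rewrite cardsE; have /card_uniqP -> : uniq (take s (enum A)).
      by rewrite take_uniq // enum_uniq.
    by rewrite size_take -cardE; case: ltngtP hs.
  by have [i /(subsetP BA)/Aa/negbTE->] := cov f B f_mono Bs.
pose g c j := c - maxn (height a c j) (c - t).
have height_le c j : c <= r -> height a c j <= c.
  move: c; apply: nat_le_ind => // i IH; have := height_step a i j; lia.
have gE j : forall c, c <= r -> cum (set_of_cum r g) c j = g c j.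
  move=> c; apply: cum_set_of_cum => [k|i k]; first by rewrite /g.
  have := height_step a i k; have := height_le i k (ltnW (ltn_ord i)).
  by rewrite /g; case: (_ \notin _); lia.
exists (set_of_cum r g).
  apply/isotoneP; split=> [j|j k c jk].
    by rewrite gE // /g; have := height_lt j; lia.
  have main c' : c' <= r -> cum (set_of_cum r g) c' k <= cum (set_of_cum r g) c' j.
    by move=> cr; rewrite !gE // /g; have := height_mono a c' jk; lia.
  by have [/main//|/ltnW rc] := leqP c r; rewrite !(cum_sat _ _ rc) main.
apply/subsetP => -[i j]; rewrite inE /= => /eqP gS; apply: contraT => ija.
have := height_step a i j; rewrite ija; move: gS; rewrite /g.
have := height_le i j (ltnW (ltn_ord i)); have := height_le i.+1 j (ltn_ord i); lia.
Qed.

Lemma card_isotone a : isotone t le a -> #|a| = n * t.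
Proof.
move=> /isotoneP[top _]; rewrite -sum1_card big_mkcond /=.
rewrite (reindex (fun ji : 'I_n * 'I_r => (ji.2, ji.1))) /=; last first.
  by exists (fun ij => (ij.2, ij.1)) => -[].
rewrite -(pair_bigA _ (fun j i => if (i, j) \in a then 1 else 0)) /=.
rewrite (eq_bigr (fun _ => t)) ?sum_nat_const ?card_ord // => j _.
rewrite -(top j) /cum; apply: eq_big => [i|i _]; first by rewrite ltn_ord.
by case: (_ \in _).
Qed.

Lemma isotone_subset_eq a b : isotone t le a -> isotone t le b -> b \subset a -> b = a.
Proof.
by move=> /card_isotone ca /card_isotone cb ba; apply/eqP; rewrite eqEcard ba ca cb leqnn.
Qed.

End Covers.

(** * The Rees ring of the dual of a multichain ideal *)

Section Multichains.

Local Open Scope ring_scope.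

Variables (K : fieldType) (d : Order.disp_t) (P : finPOrderType d).
Variables (n : nat) (p : 'I_n -> P).
Hypothesis p_bij : bijective p.
Variables (r s : nat).
Hypothesis s_ge1 : (1 <= s)%N.
Hypothesis s_le_r : (s <= r)%N.

Local Notation cell := ('I_r * 'I_n)%type.
Local Notation S := {mpoly K[r * n]}.
Local Notation H := (multichain_dual K r p s).

Definition col_le : rel 'I_n := fun j k => (p j <= p k)%O.

Lemma col_le_refl : reflexive col_le.
Proof. by move=> j; apply: Order.POrderTheory.lexx. Qed.

Lemma col_le_trans : transitive col_le.
Proof. by move=> k j l; apply: Order.POrderTheory.le_trans. Qed.

Lemma col_le_anti : ssrbool.antisymmetric col_le.
Proof.
move=> j k /Order.POrderTheory.le_anti; exact: (bij_inj p_bij).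
Qed.

Local Notation L := (lattice r (r - s).+1 col_le).

Definition cell_var (x : cell) : 'I_(r * n) := mxvec_index x.1 x.2.

Definition var_cell (k : 'I_(r * n)) : cell :=
  enum_val (cast_ord (esym (mxvec_cast r n)) k).

Lemma cell_varK : cancel cell_var var_cell.
Proof. by move=> -[i j]; rewrite /var_cell /cell_var /mxvec_index cast_ordK enum_rankK. Qed.

Lemma var_cellK : cancel var_cell cell_var.
Proof. by move=> k; case/mxvec_indexP: k => i j; rewrite (cell_varK (i, j)). Qed.

Definition var_set (a : {set cell}) : {set 'I_(r * n)} := [set k | var_cell k \in a].

Definition cell_set (F : {set 'I_(r * n)}) : {set cell} := [set x | cell_var x \in F].

Lemma var_setK : cancel var_set cell_set.
Proof. by move=> a; apply/setP => x; rewrite !inE cell_varK. Qed.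

Definition cell_exp (a : L) : 'X_{1..r * n} :=
  [multinom (var_cell k \in cells a : nat) | k < r * n].

Lemma cell_expX a :
  'X_[cell_exp a] = \prod_(k in var_set (cells a)) 'X_k :> S.
Proof.
rewrite mpolyXE_id [RHS]big_mkcond /=; apply: eq_bigr => k _.
by rewrite mnmE inE; case: ifP; rewrite ?expr1 ?expr0.
Qed.

Lemma mdeg_cell_exp a : mdeg (cell_exp a) = (n * (r - s).+1)%N.
Proof.
rewrite -(card_isotone (valP a)) mdegE -sum1_card (reindex cell_var) /=; last first.
  by exists var_cell => k _; rewrite ?cell_varK ?var_cellK.
rewrite [RHS]big_mkcond; apply: eq_bigr => x _.
by rewrite mnmE cell_varK /cells; case: (_ \in _).
Qed.

Definition chain_edge (l : seq 'I_(r * n)) : Prop :=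
  exists c (A : {set 'I_r}), [/\ multichain p c, #|A| = s &
    l = [seq cell_var (i, c i) | i <- enum A]].

Lemma multichain_monomialE c (A : {set 'I_r}) :
  multichain_monomial K c A = \prod_(k <- [seq cell_var (i, c i) | i <- enum A]) 'X_k.
Proof. by rewrite big_map big_enum. Qed.

Lemma multichain_ideal_sub (Q : {pred S}) : prime_ideal Q ->
  {subset multichain_ideal K r p s <= Q} <->
  forall l, chain_edge l -> \prod_(i <- l) 'X_i \in Q.
Proof.
move=> [[Q0 _ QD] _]; split=> [IQ l [c [A [mc As ->]]]|h].
  rewrite -multichain_monomialE; apply/IQ/ideal_gen_incl/asboolP.
  by exists c, A.
apply: ideal_gen_subset => // f /asboolP[c [A [mc As ->]]].
by rewrite multichain_monomialE; apply: h; exists c, A.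
Qed.

Lemma chain_cover F :
  vertex_cover chain_edge F <-> meets_chains s col_le (cell_set F).
Proof.
split=> h.
  move=> c A mc As; have [|k /mapP[i]] := h [seq cell_var (i, c i) | i <- enum A].
    by exists c, A.
  by rewrite mem_enum => iA -> kF; exists i; rewrite ?inE.
move=> l [c [A [mc As ->]]]; have [i iA] := h c A mc As; rewrite inE => iF.
by exists (cell_var (i, c i)) => //; apply: map_f; rewrite mem_enum.
Qed.

(** A cover inside an isotone set contains an isotone set, which has the same
    number of cells: so the isotone sets are exactly the minimal covers. *)
Lemma minimal_primes F : minimal_prime (multichain_ideal K r p s) (@var_ideal K _ F) <->
  exists a : L, F = var_set (cells a).
Proof.
have iso_cover (a : L) : vertex_cover chain_edge (var_set (cells a)).
  by apply/chain_cover; rewrite var_setK; apply: isotone_meets_chains (valP a).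
have cover_iso F' : vertex_cover chain_edge F' ->
    exists a : L, var_set (cells a) \subset F'.
  move=> /chain_cover/(meets_chains_isotone col_le_refl col_le_trans s_ge1 s_le_r).
  move=> [b bi bF]; exists (exist (isotone _ _) b bi).
  by apply/subsetP => k; rewrite inE => /(subsetP bF); rewrite inE var_cellK.
apply: iff_trans (minimal_prime_cover multichain_ideal_sub F) _.
split=> [[cF minF]|[a ->]].
  by have [a aF] := cover_iso F cF; exists a; rewrite (minF _ _ aF).
split=> // F' cF' F'a; have [b bF'] := cover_iso F' cF'.
have ba : cells b \subset cells a.
  apply/subsetP => x xb; have : cell_var x \in var_set (cells a).
    by apply/(subsetP F'a)/(subsetP bF'); rewrite inE cell_varK.
  by rewrite inE cell_varK.
have e : cells b = cells a := isotone_subset_eq (valP a) (valP b) ba.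
by apply/eqP; rewrite eqEsubset F'a -e.
Qed.

Lemma dual_gen (f : S) : f \in H ->
  f \in ideal_gen (fun f => `[< exists a, f = 'X_[cell_exp a] >]).
Proof.
apply: ideal_gen_subset.
- exact: ideal_gen0.
- by move=> a u v uI vI; apply: ideal_genD => //; apply: ideal_genM.
move=> g /asboolP[F /minimal_primes[a ->] ->].
by apply/ideal_gen_incl/asboolP; exists a; rewrite cell_expX.
Qed.

Lemma cell_exp_dual a : 'X_[cell_exp a] \in H.
Proof.
apply/ideal_gen_incl/asboolP; exists (var_set (cells a)); last exact: cell_expX.
by apply/minimal_primes; exists a.
Qed.

Lemma mcoeff_mul_mono (f : S) e m : (f * 'X_[e])@_m != 0 -> (e <= m)%MM.
Proof.
apply: contraTT => em; rewrite negbK [f]mpolyE mulr_suml raddf_sum big1 //= => m' _.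
rewrite -scalerAl -mpolyXD mcoeffZ mcoeffX; case: eqP => [mE|]; last by rewrite mulr0.
by case/negP: em; rewrite -mE lem_addl.
Qed.

Lemma mono_dual m : 'X_[m] \in H <-> exists a, (cell_exp a <= m)%MM.
Proof.
split=> [/dual_gen/asboolP[l [lG mE]]|[a am]].
  apply: contrapT => no; case/negP: (oner_neq0 K); apply/eqP.
  transitivity (('X_[m] : S)@_m); first by rewrite mcoeffX eqxx.
  rewrite mE raddf_sum big_seq big1 //= => z zl; apply/eqP; apply: contraT => nz.
  have /asboolP[a zE] := lG _ (map_f snd zl); case: no; exists a.
  by apply: (@mcoeff_mul_mono z.1); rewrite -zE.
by rewrite -(submK am) mpolyXD; apply/ideal_genM/cell_exp_dual.
Qed.

Lemma min_gen_dual e : min_monomial_gen H e <-> exists a, e = cell_exp a.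
Proof.
split=> [[/mono_dual[a ae] emin]|[a ->]].
  by exists a; rewrite (emin _ (cell_exp_dual a) ae).
split; first exact: cell_exp_dual.
move=> m /mono_dual[b bm] ma; have ba := lepm_trans bm ma.
have ab : cell_exp b = cell_exp a.
  have := submK ba; have : mdeg (cell_exp a - cell_exp b) = 0%N.
    by have := congr1 mdeg (submK ba); rewrite mdegD !mdeg_cell_exp; lia.
  by move/eqP; rewrite mdeg_eq0 => /eqP->; rewrite add0m.
apply/mnmP => k; apply/eqP; rewrite eqn_leq (mnm_lepP ma) /=.
by rewrite -ab (mnm_lepP bm).
Qed.

Local Notation Y := ('I_(r * n) + L)%type.

(** The pairs of generators whose product is rewritten. *)
Definition obstructed : rel Y := fun x y => match x, y with
  | inl v, inr a | inr a, inl v => raisable (var_cell v) a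
  | inr a, inr b => ~~ sorted_pair a b
  | inl _, inl _ => false
  end.

Definition gen_weight (x : Y) : nat := if x is inr a then lat_weight a else 0%N.

Lemma obstructed_sym : ssrbool.symmetric obstructed.
Proof. by move=> [v|a] [w|b] //=; rewrite /sorted_pair orbC. Qed.

Lemma obstructed_irr : irreflexive obstructed.
Proof.
move=> [//|a] /=; apply/negbTE; rewrite negbK; apply/orP; left.
by apply/nearP => c j; rewrite leqnn leqnSn.
Qed.

Lemma obstructed_rewrite x y : obstructed x y -> exists z z',
  [/\ (gen_exp cell_exp x + gen_exp cell_exp y = gen_exp cell_exp z + gen_exp cell_exp z')%MM,
      (gen_tdeg x + gen_tdeg y = gen_tdeg z + gen_tdeg z')%N &
      (gen_weight z + gen_weight z' < gen_weight x + gen_weight y)%N].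
Proof.
have raise v (a : L) : raisable (var_cell v) a -> exists (b : L) w,
    (U_(v) + cell_exp a = U_(w) + cell_exp b)%MM /\ (lat_weight b < lat_weight a)%N.
  move=> /raise_exists[b [w [e wt]]]; exists b, (cell_var w); split=> //.
  apply/mnmP => k; rewrite !mnmDE !mnm1E !mnmE.
  have := e (var_cell k); rewrite (can2_eq cell_varK var_cellK) (can_eq var_cellK).
  by rewrite [w == _]eq_sym [v == _]eq_sym => eE; rewrite addnC -eE addnC.
case: x y => [v|a] [w|b] //=.
- by move=> /raise[a [x [e wt]]]; exists (inl x), (inr a).
- move=> /raise[b [x [e wt]]]; exists (inr b), (inl x); split=> //=.
    by rewrite addmC e addmC.
  by rewrite !addn0.
move=> /sort_exists[a' [b' [e wt]]]; exists (inr a'), (inr b'); split=> //=.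
by apply/mnmP => k; rewrite !mnmDE !mnmE.
Qed.

Lemma exp_cellE (m : 'X_{1..#|{: Y}|}) k :
  (exp_of cell_exp m k = content (fun a : L => m (enum_rank (inr a : Y))) (var_cell k)
    + m (enum_rank (inl k : Y)))%N.
Proof.
rewrite /exp_of mnm_sumE (reindex _ (onW_bij _ (enum_rank_bij Y))) /=.
rewrite big_sumType /= addnC; congr (_ + _)%N.
  apply: eq_bigr => a _; rewrite mulmnE enum_rankK /= mnmE mulnC.
  by [].
rewrite (bigD1 k) //= mulmnE enum_rankK /= mnm1E eqxx mul1n big1 ?addn0 // => v vk.
by rewrite mulmnE enum_rankK /= mnm1E (negbTE vk).
Qed.

Lemma tdeg_latE (m : 'X_{1..#|{: Y}|}) :
  tdeg_of m = (\sum_(a : L) m (enum_rank (inr a : Y)))%N.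
Proof.
rewrite /tdeg_of (reindex _ (onW_bij _ (enum_rank_bij Y))) /=.
rewrite big_sumType /= big1 ?add0n.
  by apply: eq_bigr => a _; rewrite enum_rankK mul1n.
by move=> v _; rewrite enum_rankK.
Qed.

(** The exponent of a monomial is the content of its [T]-part plus the residue
    formed by the variables [x_v].  [csum_maximal], used in both directions,
    equates the counts of the [T]-parts. *)
Lemma standard_unique (m m' : 'X_{1..#|{: Y}|}) :
  let bad i j := obstructed (enum_val i) (enum_val j) in
  standard bad m -> standard bad m' ->
  exp_of cell_exp m = exp_of cell_exp m' -> tdeg_of m = tdeg_of m' -> m = m'.
Proof.
move=> bad sm sm' eE tE.
pose lat (e : 'X_{1..#|{: Y}|}) (a : L) := e (enum_rank (inr a : Y)).
pose res (e : 'X_{1..#|{: Y}|}) (x : cell) := e (enum_rank (inl (cell_var x) : Y)).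
have srt e : standard bad e -> all_sorted (lat e).
  move=> /standardP se a b ea eb; have := se _ _ ea eb.
  by rewrite /bad !enum_rankK /= => /negbFE.
have stuck e : standard bad e -> forall x a, (0 < res e x)%N -> (0 < lat e a)%N ->
    ~~ raisable x a.
  move=> /standardP se x a ex ea; have := se _ _ ex ea.
  by rewrite /bad !enum_rankK /= cell_varK => ->.
have tot : (\sum_a lat m a = \sum_a lat m' a)%N by rewrite -!tdeg_latE.
have same x : (content (lat m) x + res m x = content (lat m') x + res m' x)%N.
  have := congr1 (fun e : 'X_{1..r * n} => e (cell_var x)) eE.
  by rewrite !exp_cellE !cell_varK.
have lat_eq : lat m =1 lat m'.
  apply: all_sorted_unique; [exact: srt|exact: srt|by []|] => c j cr.
  apply/eqP; rewrite eqn_leq.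
  rewrite (csum_maximal col_le_refl col_le_trans col_le_anti (srt _ sm') (stuck _ sm')
    (esym tot) (fun x => esym (same x)) j cr).
  exact: (csum_maximal col_le_refl col_le_trans col_le_anti (srt _ sm) (stuck _ sm)
    tot same j cr).
apply/mnmP => i; rewrite -[i]enum_valK; case: (enum_val i) => [v|a]; last exact: lat_eq.
have := same (var_cell v); rewrite /res !var_cellK.
rewrite (_ : content (lat m) _ = content (lat m') (var_cell v)); first by move/addnI.
by apply: eq_bigr => a _; rewrite lat_eq.
Qed.

Lemma multichain_rees_koszul : koszul (rees_gr H).
Proof.
exact: (monomial_rees_koszul dual_gen cell_exp_dual mdeg_cell_exp min_gen_dual
  obstructed_sym obstructed_irr obstructed_rewrite standard_unique).
Qed.

End Multichains.

Theorem corollary6p4 (K : fieldType) (d : Order.disp_t) (P : finPOrderType d)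
  (n : nat) (p : 'I_n -> P) (p_bij : bijective p)
  (r s : nat) (s_ge1 : (1 <= s)%N) (s_le_r : (s <= r)%N) :
  koszul (rees_gr (multichain_dual K r p s)).
Proof. exact: multichain_rees_koszul. Qed.
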